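(* Let $n \geq 1$ be an integer, set $q = 3^n$, and let $b \in \mathbb{F}_q^\times$ be any element such that $b^{(q-1)/2} = (-1)^{n+1}$ (i.e. $b$ is a square in $\mathbb{F}_q^\times$ if $n$ is odd, and a non-square if $n$ is even). Let $E_{n,b}$ be the elliptic curve over $\mathbb{F}_{q^2}(t)$ given by the Weierstrass equation $y^2 = x^3 + bx + t^{3^n+1}$. Then \[ L\big(E_{n,b}/\mathbb{F}_{q^2}(t), T\big) = (1 - q^2 T)^{2\cdot 3^n}. \] In particular, the analytic rank of $E_{n,b}$ over $\mathbb{F}_{q^2}(t)$ (the order of vanishing of $L$ at $T = q^{-2}$) is equal to $2 \cdot 3^n$.
   Context: For an elliptic curve $E$ over $K = k(t)$ with $k$ a finite field, and a place $v$ of $K$ with residue field $\mathbb{F}_v$ and degree $\deg(v) = [\mathbb{F}_v : k]$, let $\overline{E_v}$ be the reduction of a minimal integral Weierstrass model of $E$ at $v$, and set $a_v(E) = |\mathbb{F}_v| + 1 - |\overline{E_v}(\mathbb{F}_v)|$. The local factor is $L_v(E/K,T) = 1 - a_v(E)T^{\deg v} + |k|^{\deg v} T^{2\deg v}$ if $E$ has good reduction at $v$, and $L_v(E/K,T) = 1 - a_v(E) T^{\deg v}$ otherwise. The $L$-function is $L(E/K,T) = \prod_v L_v(E/K,T)^{-1} \in \mathbb{Z}[[T]]$, the product over all places $v$ of $K$. *)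

(* Defs.v *)
From HB Require Import structures.
From Stdlib Require Import ClassicalEpsilon.
From mathcomp Require Import all_boot all_order all_algebra all_field.

Set Implicit Arguments.
Unset Strict Implicit.
Unset Printing Implicit Defensive.

Import GRing.Theory Num.Theory.
Local Open Scope ring_scope.

(* y^2 + a1 x y + a3 y = x^3 + a2 x^2 + a4 x + a6 *)
Record weierstrass (R : Type) := Weierstrass {
  wa1 : R; wa2 : R; wa3 : R; wa4 : R; wa6 : R
}.

Definition map_weierstrass (R S : Type) (f : R -> S) (W : weierstrass R) :
    weierstrass S :=
  Weierstrass (f (wa1 W)) (f (wa2 W)) (f (wa3 W)) (f (wa4 W)) (f (wa6 W)).

Definition disc (R : comNzRingType) (W : weierstrass R) : R :=
  let: Weierstrass a1 a2 a3 a4 a6 := W in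
  let b2 := a1 ^+ 2 + 4%:R * a2 in
  let b4 := 2%:R * a4 + a1 * a3 in
  let b6 := a3 ^+ 2 + 4%:R * a6 in
  let b8 := a1 ^+ 2 * a6 + 4%:R * a2 * a6 - a1 * a3 * a4 + a2 * a3 ^+ 2
            - a4 ^+ 2 in
  - b2 ^+ 2 * b8 - 8%:R * b4 ^+ 3 - 27%:R * b6 ^+ 2 + 9%:R * b2 * b4 * b6.

Definition elliptic (R : comNzRingType) (W : weierstrass R) : bool :=
  disc W != 0.

(* The substitution x = u^2 x' + r, y = u^3 y' + s u^2 x' + t. *)
Definition change_vars (K : fieldType) (u r s t : K) (W : weierstrass K) :
    weierstrass K :=
  let: Weierstrass a1 a2 a3 a4 a6 := W in
  Weierstrass
    ((a1 + 2%:R * s) / u)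
    ((a2 - s * a1 + 3%:R * r - s ^+ 2) / u ^+ 2)
    ((a3 + r * a1 + 2%:R * t) / u ^+ 3)
    ((a4 - s * a3 + 2%:R * r * a2 - (t + r * s) * a1 + 3%:R * r ^+ 2
      - 2%:R * s * t) / u ^+ 4)
    ((a6 + r * a4 + r ^+ 2 * a2 + r ^+ 3 - t * a3 - t ^+ 2 - r * t * a1)
      / u ^+ 6).

Definition model_of (K : fieldType) (E W : weierstrass K) : Prop :=
  exists u r s t : K, u != 0 /\ W = change_vars u r s t E.

Definition affine_points (F : finFieldType) (W : weierstrass F) :
    {set F * F} :=
  [set P | P.2 ^+ 2 + wa1 W * P.1 * P.2 + wa3 W * P.2
           == P.1 ^+ 3 + wa2 W * P.1 ^+ 2 + wa4 W * P.1 + wa6 W].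

(* The projective Weierstrass cubic, singular or not, has exactly one point on
   the line at infinity. *)
Definition npoints (F : finFieldType) (W : weierstrass F) : nat :=
  #|affine_points W|.+1.

Section RationalFunctionField.
Variable k : finFieldType.
Local Notation K := {fraction {poly k}}.

Definition finite_place : Type :=
  {p : {poly k} | (p \is monic) && irreducibleb p}.

(* [Some p] is the p-adic place, [None] the place 1/t at infinity. *)
Definition place : Type := option finite_place.

Definition place_deg (v : place) : nat :=
  if v is Some p then (size (sval p)).-1 else 1%N.

Lemma finite_place_irreducible (p : finite_place) :
  monic_irreducible_poly (sval p).
Proof. by case: p => p /= /andP[pm /irreducibleP pi]; split. Qed.

Definition residue_field (v : place) : finFieldType :=
  match v with
  | Some p => {poly %/ (sval p) with (finite_place_irreducible p)}
  | None => k
  end.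

Lemma card_residue_field (v : place) :
  #|residue_field v| = (#|k| ^ place_deg v)%N.
Proof. by case: v => [p|] /=; [exact: card_qfpoly | rewrite expn1]. Qed.

(* [repr x] need not be in lowest terms. *)
Definition fnum (x : K) : {poly k} :=
  \n_(repr x) %/ gcdp \n_(repr x) \d_(repr x).
Definition fden (x : K) : {poly k} :=
  \d_(repr x) %/ gcdp \n_(repr x) \d_(repr x).

(* The multiplicity of the nonconstant p in a <> 0. *)
Definition pmult (p a : {poly k}) : nat :=
  (\max_(i < size a | (p ^+ i %| a)%R) i)%N.

(* The normalized valuation at v of x <> 0. *)
Definition ordv (v : place) (x : K) : int :=
  match v with
  | Some p => (pmult (sval p) (fnum x))%:Z - (pmult (sval p) (fden x))%:Z
  | None => (size (fden x))%:Z - (size (fnum x))%:Z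
  end.

Definition integral_at (v : place) (x : K) : bool :=
  (x == 0) || (0 <= ordv v x).

(* Meaningful only on the elements integral at v; at infinity, the value of
   a / b with deg a <= deg b is the ratio of the coefficients of degree deg b. *)
Definition reduce_at (v : place) : K -> residue_field v :=
  match v with
  | Some p => fun x =>
      let red (a : {poly k}) :
          {poly %/ (sval p) with (finite_place_irreducible p)} :=
        in_qpoly (sval p) a in
      red (fnum x) / red (fden x)
  | None => fun x => (fnum x)`_(size (fden x)).-1 / lead_coef (fden x)
  end.

Definition integral_model (E : weierstrass K) (v : place)
    (W : weierstrass K) : Prop :=
  model_of E W /\
  [/\ integral_at v (wa1 W), integral_at v (wa2 W), integral_at v (wa3 W),
      integral_at v (wa4 W) & integral_at v (wa6 W)].

Definition minimal_integral_model (E : weierstrass K) (v : place)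
    (W : weierstrass K) : Prop :=
  integral_model E v W /\
  forall W', integral_model E v W' -> ordv v (disc W) <= ordv v (disc W').

Definition minimal_model (E : weierstrass K) (v : place) : weierstrass K :=
  epsilon (inhabits E) (minimal_integral_model E v).

Definition reduction (E : weierstrass K) (v : place) :
    weierstrass (residue_field v) :=
  map_weierstrass (@reduce_at v) (minimal_model E v).

Definition good_reduction (E : weierstrass K) (v : place) : bool :=
  disc (reduction E v) != 0.

Definition trace_at (E : weierstrass K) (v : place) : int :=
  #|residue_field v|%:Z + 1 - (npoints (reduction E v))%:Z.

Definition local_factor (E : weierstrass K) (v : place) : {poly int} :=
  let d := place_deg v in
  if good_reduction E v then
    1 - (trace_at E v)%:P * 'X^d + ((#|k| ^ d)%N%:Z)%:P * 'X^(2 * d)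
  else 1 - (trace_at E v)%:P * 'X^d.

End RationalFunctionField.

(* Z[[T]]; [f n] is the coefficient of T^n. *)
Definition fps : Type := nat -> int.

Definition fps_of_poly (p : {poly int}) : fps := fun n => p`_n.

Definition fps_mul (f g : fps) : fps :=
  fun n => \sum_(i < n.+1) f i * g (n - i)%N.

(* 1 / p = sum_j (1 - p)^j when p has constant coefficient 1. *)
Definition fps_inv (p : {poly int}) : fps :=
  fun n => (\sum_(j < n.+1) (1 - p) ^+ j)`_n.

(* Unconditional T-adic convergence of the product of the f i to l. *)
Definition fps_prod_to (I : eqType) (f : I -> fps) (l : fps) : Prop :=
  forall n, exists s0 : seq I, forall s : seq I,
    uniq s -> {subset s0 <= s} ->
    (\big[fps_mul/fps_of_poly 1]_(i <- s) f i) n = l n.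

Definition Lfunction (k : finFieldType) (E : weierstrass {fraction {poly k}}) :
    fps :=
  epsilon (inhabits (fps_of_poly 0))
    (fps_prod_to (fun v : place k => fps_inv (local_factor E v))).

(* f is the expansion of a nonzero rational function whose order at x is r. *)
Definition order_at (f : fps) (x : rat) (r : int) : Prop :=
  exists N D : {poly rat},
    [/\ N != 0, D != 0,
        forall n, \sum_(i < n.+1) D`_i * (f (n - i)%N)%:~R = N`_n
      & r = (mup x N)%:Z - (mup x D)%:Z].

Definition analytic_rank (k : finFieldType)
    (E : weierstrass {fraction {poly k}}) : int :=
  epsilon (inhabits (0 : int)) (order_at (Lfunction E) (#|k|%:R^-1)).

(* y^2 = x^3 + b x + t^(3^n + 1) *)
Definition curve_E (k : finFieldType) (n : nat) (b : k) :
    weierstrass {fraction {poly k}} :=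
  Weierstrass 0 0 0 (FracField.tofrac b%:P)
    (FracField.tofrac 'X^((3 ^ n).+1)).

(* Main.v *)
(* Write q = 3^n, c = iota b and choose lam in k with lam^2 c^3 = -1; the condition
   on b gives lam^q = - lam.  At a finite place v of degree d the cubic x^3 + c x is
   additive, so counting points with additive characters and evaluating a quadratic
   Gauss sum yields
     L_v = (1 - psi_v (-q T)^d) (1 - psi_v^-1 (-q T)^d),
   where psi_v is the character of the trace of lam t^(q+1) at v.  At infinity the
   reduction is cuspidal because q + 1 is prime to 3, and the local factor is 1.
   Hence L is a product of two Artin-Schreier L-functions in U = - q T, whose
   logarithmic derivatives have as coefficients the sums of psi(lam t^(q+1)) over
   the extension of k of degree m.  This is a quadratic form with radical k, so the
   sum is (-1)^(m+1) q^(m+1), its sign being forced by invariance under the (q+1)-th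
   roots of unity.  Therefore each of the two series equals (1 + q U)^q. *)

From HB Require Import structures.
From Stdlib Require Import Classical ClassicalEpsilon FunctionalExtensionality.
Require Import Defs.
From mathcomp Require Import all_boot all_order all_algebra all_field.
From mathcomp Require Import ring zify.
Import Order.TTheory GRing.Theory Num.Theory.
Local Open Scope ring_scope.

Set Implicit Arguments.
Unset Strict Implicit.
Unset Printing Implicit Defensive.

(** * Additive characters in characteristic 3 *)

(** The frequency lam arises as follows: the character of w (x^3 + c x) is trivial in x exactly when
    w + c^3 w^3 = 0, so the nonzero frequencies are the two square roots of -1/c^3. The relation
    lam^q = - lam is used three times. It makes t -> t^q carry the form lam t^(q+1) to its negative,
    so the exponential sums are integers; it makes the form degenerate along the whole subfield of
    order q^2; and it gives the Gauss sum at a place of degree d the value -(-q)^d for both parities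
    of d. Absolute values come easily and signs are the delicate point. Gauss sums get theirs by
    averaging over the subfield of order sqrt|F|, Hermitian sums by a congruence modulo q + 1. The
    other obstacle is that [minimal_model] is an arbitrary choice made by [epsilon], so reductions
    are determined for every admissible change of variables. This is feasible because in
    characteristic 3 the discriminant is the constant -c^3 and r, s, t are controlled by u and the
    coefficients of the model. Infinite products enter only as congruences modulo X^(N+1) for finite
    products over any list containing all places of degree at most N. *)

Lemma card_roots_dvd_genPoly (F : finFieldType) (p : {poly F}) :
  p %| 'X^#|F| - 'X -> #|[set x | root p x]| = (size p).-1.
Proof.
rewrite finField_genPoly -big_enum /= => /dvdp_prod_XsubC[m pE].
rewrite (eqp_size pE) size_prod_XsubC /=.
have /card_uniqP <- : uniq (mask m (enum F)) by rewrite mask_uniq ?enum_uniq.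
by apply: eq_card => x; rewrite inE (eqp_root pE) root_prod_XsubC.
Qed.

Lemma dvdp_subXX (R : idomainType) (x y : {poly R}) n : x - y %| x ^+ n - y ^+ n.
Proof. by rewrite subrXX dvdp_mulr. Qed.

(** The condition on c makes X^e - c divide X^(|F|-1) - 1, which has distinct roots, all in F. *)
Lemma card_roots_Xn (F : finFieldType) e (c : F) : (0 < e)%N ->
  (e %| #|F|.-1)%N -> c ^+ (#|F|.-1 %/ e) = 1 -> #|[set x : F | x ^+ e == c]| = e.
Proof.
move=> e0 ed ce.
have F0 : (0 < #|F|)%N := ltnW (finNzRing_gt1 F).
have := @card_roots_dvd_genPoly F ('X^e - c%:P).
rewrite size_XnsubC //= => h; rewrite -[RHS]h; first by
  apply: eq_card => x; rewrite !inE rootE !hornerE subr_eq0.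
have -> : 'X^#|F| - 'X = 'X * ('X^e ^+ (#|F|.-1 %/ e) - c%:P ^+ (#|F|.-1 %/ e)).
  rewrite -exprM -rmorphXn /= ce mulrBr mulr1 mulnC divnK // -exprS.
  by rewrite prednK.
by rewrite dvdp_mull ?dvdp_subXX.
Qed.

Definition omega : algC := sval (C_prim_root_exists (isT : 0 < 3)%N).

Lemma omega_prim : 3.-primitive_root omega.
Proof. exact: (svalP (C_prim_root_exists (isT : 0 < 3)%N)). Qed.

Lemma omega3 : omega ^+ 3 = 1. Proof. exact: prim_expr_order omega_prim. Qed.

Lemma omega_neq1 : omega != 1.
Proof.
by have := prim_order_dvd omega_prim 1; rewrite expr1 /= => h; rewrite -h.
Qed.

Lemma omega_sum : 1 + omega + omega ^+ 2 = 0.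
Proof.
have /eqP : (omega - 1) * (1 + omega + omega ^+ 2) = 0.
  transitivity (omega ^+ 3 - 1); first by ring.
  by rewrite omega3 subrr.
by rewrite mulf_eq0 subr_eq0 (negPf omega_neq1) /= => /eqP.
Qed.

(** The absolute trace to the prime field. Reading the degree off [#|F|] lets one definition serve
    k, its extensions and all residue fields. *)
Definition ftrace (F : finFieldType) (z : F) : F :=
  \sum_(i < logn 3 #|F|) z ^+ (3 ^ i).

(* Meaningful only on the prime field {0, 1, -1}. *)
Definition chi3 (F : finFieldType) (z : F) : algC :=
  if z == 0 then 1 else if z == 1 then omega else omega ^+ 2.

Definition addchar (F : finFieldType) (z : F) : algC := chi3 (ftrace z).

Section AdditiveCharacter.
Variables (F : finFieldType) (r : nat).
Hypothesis cardF : #|F| = (3 ^ r)%N.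
Implicit Types x y z : F.

Lemma pchar3 : 3 \in [pchar F].
Proof. exact: card_finPcharP cardF _. Qed.

Lemma three_eq0 : 3%:R = 0 :> F.
Proof. by case/andP: pchar3 => _ /eqP. Qed.

Lemma pnat_pchar3 i : [pchar F].-nat (3 ^ i)%N.
Proof. by rewrite pnatX pnatE // pchar3. Qed.

Lemma expD3 i x y : (x + y) ^+ (3 ^ i) = x ^+ (3 ^ i) + y ^+ (3 ^ i).
Proof. exact: exprDn_pchar (pnat_pchar3 i). Qed.

Lemma expN3 i x : (- x) ^+ (3 ^ i) = - x ^+ (3 ^ i).
Proof. exact: exprNn_pchar (pnat_pchar3 i). Qed.

Lemma exp3_inj i : injective (fun x => x ^+ (3 ^ i)).
Proof.
move=> x y /eqP; rewrite -subr_eq0 -expN3 -expD3 expf_eq0 subr_eq0.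
by case/andP=> _ /eqP.
Qed.

Lemma two_neq0 : 2%:R != 0 :> F.
Proof.
by apply/eqP => h; have := three_eq0; rewrite -[3%N]/(1 + 2)%N natrD h addr0;
  move/eqP; rewrite oner_eq0.
Qed.

Lemma neg1_neq1 : (-1 == 1 :> F) = false.
Proof.
apply/negbTE; apply: contra two_neq0 => /eqP h.
by rewrite -[2%N]/(1 + 1)%N natrD -{1}h addNr.
Qed.

Lemma ftraceE z : ftrace z = \sum_(i < r) z ^+ (3 ^ i).
Proof. by rewrite /ftrace cardF pfactorK. Qed.

Lemma ftraceD x y : ftrace (x + y) = ftrace x + ftrace y.
Proof.
by rewrite !ftraceE -big_split; apply: eq_bigr => i _; rewrite /= expD3.
Qed.

Lemma ftrace0 : ftrace (0 : F) = 0.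
Proof. by apply: (@addIr _ (ftrace (0 : F))); rewrite -ftraceD !add0r. Qed.

Lemma ftraceN x : ftrace (- x) = - ftrace x.
Proof. by apply: (@addIr _ (ftrace x)); rewrite -ftraceD !addNr ftrace0. Qed.

Lemma ftrace_frob z : ftrace (z ^+ 3) = ftrace z.
Proof.
rewrite !ftraceE; case: r cardF => [|r'] cF; first by rewrite !big_ord0.
rewrite big_ord_recr big_ord_recl /= expr1 addrC -exprM -expnS -cF expf_card.
by congr (_ + _); apply: eq_bigr => i _; rewrite -exprM -expnS.
Qed.

Lemma ftrace_cube z : ftrace z ^+ 3 = ftrace z.
Proof.
rewrite -[RHS]ftrace_frob !ftraceE.
have := @big_morph _ _ (fun x : F => x ^+ 3) 0 +%R 0 +%R (expD3 1) (expr0n _ 3).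
by move=> ->; apply: eq_bigr => i _; rewrite -!exprM mulnC.
Qed.

Lemma cube_fixed_cases z : z ^+ 3 = z -> [\/ z = 0, z = 1 | z = -1].
Proof.
move=> z3; have : z * ((z - 1) * (z + 1)) = 0.
  transitivity (z ^+ 3 - z); first by ring.
  by rewrite z3 subrr.
move/eqP; rewrite !mulf_eq0 subr_eq0 addr_eq0.
by case/or3P => /eqP ->; [constructor 1|constructor 2|constructor 3].
Qed.

Lemma ftrace_cases z : [\/ ftrace z = 0, ftrace z = 1 | ftrace z = -1].
Proof. exact/cube_fixed_cases/ftrace_cube. Qed.

Lemma chi3D x y : x ^+ 3 = x -> y ^+ 3 = y -> chi3 (x + y) = chi3 x * chi3 y.
Proof.
have w4 : omega ^+ 2 * omega ^+ 2 = omega.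
  by rewrite -exprD -[(2+2)%N]/(3 + 1)%N exprD omega3 mul1r.
have t0 : (1 + 1 : F) = -1.
  by apply/eqP; rewrite -subr_eq0 -three_eq0; apply/eqP; ring.
have oo : (-1 == 0 :> F) = false by rewrite oppr_eq0 oner_eq0.
have s0 : (-1 - 1 : F) = 1 by rewrite -opprD t0 opprK.
move=> /cube_fixed_cases hx /cube_fixed_cases hy; rewrite /chi3.
by case: hx => ->; case: hy => ->;
  rewrite ?(add0r, addr0, subrr, addNr, t0, s0) ?eqxx ?oner_eq0 ?oo ?neg1_neq1
    ?(mul1r, mulr1) -?expr2 ?w4 -?exprS -?exprSr ?omega3.
Qed.

Lemma chi3Mn e x : x ^+ 3 = x -> chi3 (x *+ e) = chi3 x ^+ e.
Proof.
move=> x3; elim: e => [|e IH]; first by rewrite mulr0n expr0 /chi3 eqxx.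
rewrite mulrS exprS chi3D // ?IH // -[x in RHS]x3.
elim: {IH} e => [|e IH]; first by rewrite !mulr0n expr0n.
by rewrite !mulrS (expD3 1) IH.
Qed.

Lemma addchar0 : addchar (0 : F) = 1.
Proof. by rewrite /addchar /chi3 ftrace0 eqxx. Qed.

Lemma addcharD x y : addchar (x + y) = addchar x * addchar y.
Proof. by rewrite /addchar ftraceD chi3D ?ftrace_cube. Qed.

Lemma addchar3 z : addchar z ^+ 3 = 1.
Proof.
rewrite /addchar /chi3; case: ifP => _; first exact: expr1n.
by case: ifP => _; rewrite -?exprM ?omega3 // mulnC exprM omega3 expr1n.
Qed.

Lemma ftrace_exp3 i z : ftrace (z ^+ (3 ^ i)) = ftrace z.
Proof.
elim: i => [|i IH]; first by rewrite expr1.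
by rewrite expnSr exprM ftrace_frob.
Qed.

Lemma addchar_frob i z : addchar (z ^+ (3 ^ i)) = addchar z.
Proof. by rewrite /addchar ftrace_exp3. Qed.

Lemma addcharN z : addchar z * addchar (- z) = 1.
Proof. by rewrite -addcharD subrr addchar0. Qed.

(** A cube root of unity equal to its own inverse is 1. This is how the form is seen to be invisible
    to the character on its radical. *)
Lemma addchar_even z : addchar (- z) = addchar z -> addchar z = 1.
Proof.
move=> h; have := addcharN z; rewrite h -expr2 => h2.
by have := addchar3 z; rewrite exprS h2 mulr1.
Qed.

(** The trace is a nonzero polynomial of degree at most 3^(r-1), too small to vanish on all 3^r
    elements. *)
Lemma addchar_nontrivial : exists z, addchar z != 1.
Proof.
have r0 : (0 < r)%N.
  by rewrite lt0n; apply: contraTneq (finNzRing_gt1 F) => h; rewrite cardF h.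
pose p : {poly F} := \sum_(i < r) 'X^(3 ^ i).
have sp : (size p <= (3 ^ r.-1).+1)%N.
  apply: (leq_trans (size_sum _ _ _)); apply/bigmax_leqP => i _.
  by rewrite size_polyXn ltnS leq_exp2l //; have := ltn_ord i; lia.
have p0 : p != 0.
  apply/negP => /eqP/(congr1 (fun u : {poly F} => u`_1)); rewrite coef_sum coef0.
  rewrite (bigD1 (Ordinal r0)) //= expr1 coefX /= big1 ?addr0; first by
    move/eqP; rewrite oner_eq0.
  move=> [i /= ir] ne; rewrite coefXn; case: eqP => // h; case/eqP: ne.
  by apply: val_inj; case: i ir h => //= i _; rewrite expnS; lia.
have [z nz|all0] := pickP (fun z => ftrace z != 0).
  exists z; rewrite /addchar /chi3 (negPf nz); case: ifP => _; first exact: omega_neq1.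
  have := prim_order_dvd omega_prim 2; rewrite /= => h.
  by rewrite -h.
have := @max_poly_roots _ p (enum F) p0.
have -> : all (root p) (enum F).
  apply/allP => z _; rewrite rootE /p horner_sum.
  under eq_bigr do rewrite hornerXn.
  by rewrite -ftraceE; have := all0 z; move/negbFE.
rewrite enum_uniq -cardE cardF => /(_ isT isT) h.
by have := leq_trans h sp; rewrite ltnS leq_exp2l // leqNgt prednK ?leqnn.
Qed.

Lemma sum_addchar (a : F) :
  \sum_z addchar (a * z) = if a == 0 then #|F|%:R else 0.
Proof.
case: eqP => [->|/eqP a0].
  by under eq_bigr do rewrite mul0r addchar0; rewrite sumr_const.
have [z0 nz] := addchar_nontrivial.
have h : addchar z0 * \sum_z addchar (a * z) = \sum_z addchar (a * z).
  rewrite [RHS](reindex_inj (addrI (z0 / a))) mulr_sumr; apply: eq_bigr => z _.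
  by rewrite mulrDr mulrCA divff // mulr1 addcharD.
apply/eqP; have /eqP := h; rewrite -subr_eq0 -{2}[\sum_z _]mul1r -mulrBl mulf_eq0.
by rewrite subr_eq0 (negPf nz).
Qed.

Lemma sum_addchar_exp3 i (a : F) :
  \sum_z addchar (a * z ^+ (3 ^ i)) = if a == 0 then #|F|%:R else 0.
Proof. by rewrite -sum_addchar [RHS](reindex_inj (@exp3_inj i)). Qed.

End AdditiveCharacter.

(** * Quadratic Gauss sums *)

Lemma poly_expD3 (R : idomainType) i (p q : {poly R}) : 3 \in [pchar R] ->
  (p + q) ^+ (3 ^ i) = p ^+ (3 ^ i) + q ^+ (3 ^ i).
Proof.
by move=> c; apply: exprDn_pchar; rewrite pnatX pnatE // pchar_poly c.
Qed.

Lemma dvdp_expgt0 (R : idomainType) (p : {poly R}) n : (0 < n)%N -> p %| p ^+ n.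
Proof. by case: n => // n _; rewrite exprS dvdp_mulr. Qed.

Lemma dvdp_XexpX (R : idomainType) s e : 3 \in [pchar R] ->
  'X^(3 ^ s) - 'X %| ('X^((3 ^ s) ^ e) - 'X : {poly R}).
Proof.
move=> c; elim: e => [|e IH]; first by rewrite expn0 expr1 subrr dvdp0.
have -> : 'X^((3 ^ s) ^ e.+1) - 'X =
  ('X^((3 ^ s) ^ e) - 'X) ^+ (3 ^ s) + ('X^(3 ^ s) - 'X) :> {poly R}.
  rewrite poly_expD3 // exprNn_pchar -?exprM -?expnSr ?addrA ?subrK //.
  by rewrite pnatX pnatE // pchar_poly c.
by rewrite dvdp_add // (dvdp_trans IH) // dvdp_expgt0 // expn_gt0.
Qed.

(** The kernel of the trace to the subfield of order P: with T = X^P + X one has X^(P^2) - X = T^P -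
    T, a multiple of T, so T has all its roots in F. *)
Lemma card_exp3_antifixed (F : finFieldType) (P s : nat) :
  P = (3 ^ s)%N -> (0 < s)%N -> #|F| = (P ^ 2)%N ->
  #|[set x : F | x ^+ P + x == 0]| = P.
Proof.
move=> Ps s0 cF.
have cF' : #|F| = (3 ^ (s * 2))%N by rewrite cF Ps expnM.
have P1 : (1 < P)%N by rewrite Ps -{1}(expn0 3) ltn_exp2l.
have sz : size ('X^P + 'X : {poly F}) = P.+1.
  by rewrite size_polyDl size_polyXn // size_polyX.
have := @card_roots_dvd_genPoly F ('X^P + 'X); rewrite sz /= => h.
rewrite -[RHS]h; first by apply: eq_card => x; rewrite !inE rootE !hornerE.
have -> : 'X^#|F| - 'X = ('X^P + 'X) ^+ P - ('X^P + 'X) :> {poly F}.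
  rewrite {2}Ps poly_expD3 ?(pchar3 cF') // -Ps -exprM cF -[(P ^ 2)%N]/(P * P)%N.
  by ring.
by rewrite dvdp_sub // dvdp_expgt0 // ltnW.
Qed.

Section QuadraticGaussSum.
Variables (F : finFieldType) (s : nat).
Let P := (3 ^ s)%N.
Hypotheses (s_gt0 : (0 < s)%N) (cardF : #|F| = (P ^ 2)%N).

Definition gauss (lam : F) : algC := \sum_y addchar (lam * y ^+ 2).

Let cardF3 : #|F| = (3 ^ (s * 2))%N. Proof. by rewrite cardF /P expnM. Qed.

Let P_gt1 : (1 < P)%N. Proof. by rewrite /P -{1}(expn0 3) ltn_exp2l. Qed.

Let P_odd : odd P. Proof. by rewrite /P oddX orbT. Qed.

Let cardF_pred : #|F|.-1 = (P.-1 * P.+1)%N.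
Proof. by rewrite cardF; have := P_gt1; nia. Qed.

(** Elements of the subfield of order P become squares in F because (|F| - 1)/2 is a multiple of P -
    1. *)
Lemma exp3_fixed_sqr (r : F) : r ^+ P = r -> r != 0 -> exists2 x, x ^+ 2 = r & x != 0.
Proof.
move=> rP r0.
have r1 : r ^+ P.-1 = 1.
  by apply: (mulfI r0); rewrite -exprS prednK ?rP ?mulr1 // ltnW.
have d2 : (2 %| P.+1)%N by rewrite dvdn2 /= P_odd.
have := @card_roots_Xn F 2 r isT.
rewrite cardF_pred dvdn_mull // -muln_divA // exprM r1 expr1n => /(_ isT (erefl _)) h.
have : (0 < #|[set x : F | x ^+ 2 == r]|)%N by rewrite h.
case/card_gt0P => x; rewrite inE => /eqP xr; exists x => //.
by apply: contra r0 => /eqP x0; rewrite -xr x0 expr0n.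
Qed.

Lemma gauss_fixed_scale (lam r : F) : r ^+ P = r -> r != 0 ->
  gauss (lam * r) = gauss lam.
Proof.
move=> rP r0; have [x <- x0] := exp3_fixed_sqr rP r0.
rewrite /gauss [RHS](reindex_inj (mulfI x0)); apply: eq_bigr => y _.
by rewrite /= exprMn -mulrA.
Qed.

(* Averages [gauss (lam * r)] over r = u^P + u: the nonzero such r lie in the
   subfield of order P, hence are squares and do not change the sum. *)
Lemma gauss_avg (lam : F) :
  gauss lam * (P%:R - 1) =
  P%:R * #|[set y : F | (lam * y ^+ 2) ^+ P + lam * y ^+ 2 == 0]|%:R - P%:R ^+ 2.
Proof.
have sumu (z : F) : \sum_(u : F) addchar (z * (u ^+ P + u)) =
    (if z ^+ P + z == 0 then P%:R ^+ 2 else 0 : algC).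
  transitivity (\sum_(u : F) addchar ((z ^+ P + z) * u ^+ P)).
    apply: eq_bigr => u _; rewrite mulrDl [RHS](addcharD cardF3) -exprMn.
    by rewrite (addchar_frob cardF3) mulrDr (addcharD cardF3) mulrC.
  by rewrite (sum_addchar_exp3 cardF3) cardF natrX.
have fixu (u : F) : (u ^+ P + u) ^+ P = u ^+ P + u.
  by rewrite /P (expD3 cardF3) -exprM -[(_ * _)%N]/(P ^ 2)%N -cardF expf_card addrC.
(* The P values of u with u^P + u = 0 each give |F| = P^2; the remaining P^2 - P each give
   [gauss lam]. *)
have e1 : \sum_(u : F) gauss (lam * (u ^+ P + u)) =
    P%:R * P%:R ^+ 2 + gauss lam * (P%:R ^+ 2 - P%:R).
  rewrite (bigID (fun u : F => u ^+ P + u == 0)) /=; congr (_ + _).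
    rewrite (eq_bigr (fun=> P%:R ^+ 2 : algC)); last first.
      move=> u /eqP ->; rewrite /gauss mulr0.
      by under eq_bigr do rewrite mul0r (addchar0 cardF3); rewrite sumr_const -natrX cardF.
    rewrite sumr_const mulr_natl; congr (_ *+ _).
    rewrite -[RHS](card_exp3_antifixed (erefl P) s_gt0 cardF).
    by apply: eq_card => x; rewrite !inE.
  rewrite (eq_bigr (fun=> gauss lam)); last first.
    by move=> u u0; rewrite gauss_fixed_scale // fixu.
  rewrite sumr_const -[LHS]mulr_natr; congr (_ * _).
  have := cardC [pred u : F | u ^+ P + u == 0].
  rewrite cardF => /(congr1 (fun n : nat => n%:R : algC)).
  have -> : #|[pred u : F | u ^+ P + u == 0]| = P.
    rewrite -[RHS](card_exp3_antifixed (erefl P) s_gt0 cardF).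
    by apply: eq_card => x; rewrite !inE.
  by rewrite natrD natrX => <-; rewrite addrAC subrr add0r.
(* The same double sum with u innermost: by orthogonality only the y counted on the right
   survive. *)
have e2 : \sum_(u : F) gauss (lam * (u ^+ P + u)) = P%:R ^+ 2 *
   #|[set y : F | (lam * y ^+ 2) ^+ P + lam * y ^+ 2 == 0]|%:R.
  rewrite exchange_big /= -sum1dep_card natr_sum mulr_sumr.
  rewrite [RHS]big_mkcond /=; apply: eq_bigr => y _.
  under eq_bigr => u _ do rewrite mulrAC.
  by rewrite sumu mulr1.
have P0 : P%:R != 0 :> algC by rewrite pnatr_eq0 -lt0n ltnW.
apply: (mulfI P0); move: e1; rewrite e2; set N := #|_|%:R => e3.
have -> : P%:R * (P%:R * N - P%:R ^+ 2) = P%:R ^+ 2 * N - P%:R ^+ 3 by ring.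
by rewrite e3; ring.
Qed.

(** Here the counted equation becomes y = 0 or y^(2(P-1)) = 1, with 2(P-1) + 1 solutions, and
    [gauss_avg] reads G (P - 1) = P (2P - 1) - P^2 = P (P - 1). *)
Lemma gauss_antifixed (lam : F) : lam != 0 -> lam ^+ P = - lam ->
  gauss lam = P%:R.
Proof.
move=> l0 lP; have := gauss_avg lam.
have -> : #|[set y : F | (lam * y ^+ 2) ^+ P + lam * y ^+ 2 == 0]| = (2 * P.-1).+1.
  rewrite (cardsD1 0) !inE expr0n mulr0 expr0n addr0 /=.
  have -> : (P == 0)%N = false by have := P_gt1; case: (P).
  rewrite eqxx add1n; congr S.
  have d2 : (2 * P.-1 %| #|F|.-1)%N.
    by rewrite cardF_pred mulnC dvdn_mul // dvdn2 /= P_odd.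
  have p0 : (0 < 2 * P.-1)%N by have := P_gt1; lia.
  rewrite -[RHS](@card_roots_Xn F (2 * P.-1) 1) ?expr1n //.
  apply: eq_card => y; rewrite !inE.
  have [->|y0] := eqVneq y 0.
    by rewrite /= expr0n eqn0Ngt p0 eq_sym oner_eq0.
  rewrite /= exprMn lP mulNr addrC subr_eq0 (inj_eq (mulfI l0)).
  have -> : (y ^+ 2) ^+ P = y ^+ 2 * y ^+ (2 * P.-1).
    by rewrite -exprM -exprD; congr (_ ^+ _); have := P_gt1; lia.
  by rewrite eq_sym -subr_eq0 -{2}[y ^+ 2]mulr1 -mulrBr mulf_eq0 expf_eq0
    (negPf y0) /= subr_eq0.
have P1 : P%:R - 1 != 0 :> algC.
  by rewrite subr_eq0 (eqr_nat _ P 1) neq_ltn P_gt1 orbT.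
move=> h; apply: (mulIf P1); rewrite h.
have -> : (2 * P.-1).+1%:R = 2%:R * P%:R - 1 :> algC.
  by rewrite -{2}(prednK (ltnW P_gt1)); ring.
ring.
Qed.

(** A nonzero solution would satisfy y^(2(P-1)) = -1. As 4 divides P - 1, the exponent (P+1)/2 is
    odd, and raising to it gives y^(|F|-1) = -1, which is absurd. Only y = 0 is left, so G (P - 1) =
    P - P^2. *)
Lemma gauss_fixed (lam : F) : lam != 0 -> lam ^+ P = lam -> (4 %| P.-1)%N ->
  gauss lam = - P%:R.
Proof.
move=> l0 lP d4; have := gauss_avg lam.
have -> : #|[set y : F | (lam * y ^+ 2) ^+ P + lam * y ^+ 2 == 0]| = 1%N.
  apply/eqP/cards1P; exists 0; apply/setP => y; rewrite !inE exprMn lP -mulrDr.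
  rewrite mulf_eq0 (negPf l0) /=.
  have [->|y0] := eqVneq y 0.
    by rewrite !expr0n addr0; have := P_gt1; case: (P) => // ? _; rewrite eqxx.
  apply/negbTE/eqP => h.
  have : (y ^+ 2) ^+ P.-1 = -1.
    apply: (mulfI (expf_neq0 2 y0)); rewrite mulrN1 -exprS prednK ?(ltnW P_gt1) //.
    by apply/eqP; rewrite -addr_eq0 h.
  move/(congr1 (fun z => z ^+ (P.+1 %/ 2))); rewrite -!exprM => h1.
  have : y ^+ #|F|.-1 = 1.
    apply: (mulfI y0); rewrite mulr1 -exprS prednK ?expf_card //.
    exact: ltnW (finNzRing_gt1 F).
  have -> : #|F|.-1 = (2 * (P.-1 * (P.+1 %/ 2)))%N.
    by rewrite cardF_pred mulnCA [(2 * _)%N]mulnC divnK // dvdn2 /= P_odd.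
  rewrite h1; have -> : (P.+1 %/ 2)%N = (2 * (P.-1 %/ 4)).+1.
    by have := P_gt1; move: (P) d4 => Q; lia.
  rewrite exprS exprM sqrrN expr1n expr1n mulr1 => /eqP.
  by rewrite (neg1_neq1 cardF3).
have P1 : P%:R - 1 != 0 :> algC.
  by rewrite subr_eq0 (eqr_nat _ P 1) neq_ltn P_gt1 orbT.
by move=> h; apply: (mulIf P1); rewrite h; ring.
Qed.

End QuadraticGaussSum.

(** * Point counts and Hermitian sums *)

(* Since x^3 + b x is additive, orthogonality of characters leaves only the
   frequencies 0, lam and - lam. *)
Lemma card_supersingular_cubic (F : finFieldType) r (b lam c : F) :
  #|F| = (3 ^ r)%N -> lam ^+ 2 * b ^+ 3 = -1 ->
  #|[set P : F * F | P.2 ^+ 2 == P.1 ^+ 3 + b * P.1 + c]|%:R =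
  #|F|%:R + addchar (lam * c) * gauss (- lam)
    + addchar (- lam * c) * gauss lam.
Proof.
move=> cF lb.
have F0 : #|F|%:R != 0 :> algC by rewrite pnatr_eq0 -lt0n ltnW ?finNzRing_gt1.
have l0 : lam != 0.
  apply/eqP => l0; move/eqP: lb; rewrite l0 expr0n mul0r eq_sym oppr_eq0.
  by rewrite oner_eq0.
have nll : - lam != lam.
  rewrite -subr_eq0 -opprD oppr_eq0 -mulr2n -mulr_natr mulf_neq0 //.
  exact: two_neq0 cF.
have zer (w : F) : (w + b ^+ 3 * w ^+ 3 == 0) = [|| w == 0, w == lam | w == - lam].
  transitivity (w * ((w - lam) * (w + lam)) == 0).
    have -> : w + b ^+ 3 * w ^+ 3 = (w * ((w - lam) * (w + lam))) * b ^+ 3.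
      transitivity (b ^+ 3 * w ^+ 3 - w * (lam ^+ 2 * b ^+ 3)); last by ring.
      by rewrite lb; ring.
    rewrite mulf_eq0 orbC; case: eqP => // b0.
    by move/eqP: lb; rewrite b0 mulr0 eq_sym oppr_eq0 oner_eq0.
  by rewrite !mulf_eq0 subr_eq0 addr_eq0.
(* The character does not change when b x w is cubed; both terms are then linear in x^3, which runs
   over all of F. *)
have sumx (w : F) : \sum_x addchar ((x ^+ 3 + b * x) * w) =
    (if w + b ^+ 3 * w ^+ 3 == 0 then #|F|%:R else 0 : algC).
  rewrite -(sum_addchar_exp3 cF 1); apply: eq_bigr => x _.
  rewrite mulrDl !(addcharD cF) mulrDl (addcharD cF); congr (_ * _).
    by rewrite mulrC.
  rewrite -[LHS](addchar_frob cF 1); congr addchar.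
  by rewrite expn1; ring.
have sum3 (f : F -> algC) :
    \sum_w (if w + b ^+ 3 * w ^+ 3 == 0 then f w else 0) = f 0 + (f lam + f (- lam)).
  rewrite -big_mkcond /= (bigD1 0) ?zer ?eqxx //=; congr (_ + _).
  rewrite (bigD1 lam) ?zer ?eqxx ?orbT ?l0 //=; congr (_ + _).
  rewrite (bigD1 (- lam)) ?zer ?eqxx ?orbT ?oppr_eq0 ?l0 ?nll //=.
  rewrite big1 ?addr0 // => w /andP[/andP[/andP[]]]; rewrite zer.
  by case/or3P => /eqP->; rewrite eqxx.
(* After multiplication by |F|, the equation of the curve is detected by a sum over all frequencies
   w. *)
apply: (mulfI F0).
rewrite -sum1dep_card natr_sum mulr_sumr big_mkcond /=.
transitivity (\sum_(p : F * F) \sum_w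
    addchar ((p.1 ^+ 3 + b * p.1 + c - p.2 ^+ 2) * w)).
  apply: eq_bigr => p _; rewrite (sum_addchar cF) subr_eq0 eq_sym.
  by case: ifP; rewrite ?mulr1.
rewrite -(pair_bigA _ (fun x y : F => \sum_w
    addchar ((x ^+ 3 + b * x + c - y ^+ 2) * w))) /=.
transitivity (\sum_(w : F) \sum_(y : F) addchar ((c - y ^+ 2) * w) *
   \sum_x addchar ((x ^+ 3 + b * x) * w)).
  transitivity (\sum_(x : F) \sum_(w : F) \sum_(y : F)
     addchar ((x ^+ 3 + b * x + c - y ^+ 2) * w)).
    by apply: eq_bigr => x _; rewrite exchange_big.
  rewrite exchange_big; apply: eq_bigr => w _.
  rewrite exchange_big; apply: eq_bigr => y _.
  rewrite mulr_sumr; apply: eq_bigr => x _.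
  by rewrite -(addcharD cF) -mulrDl; congr (addchar (_ * _)); ring.
transitivity (\sum_(w : F) #|F|%:R * (if w + b ^+ 3 * w ^+ 3 == 0 then
    \sum_(y : F) addchar ((c - y ^+ 2) * w) else 0)).
  apply: eq_bigr => w _; rewrite -mulr_suml sumx.
  by case: ifP => _; rewrite ?mulr0 // mulrC.
rewrite -mulr_sumr; congr (_ * _).
rewrite sum3 -[RHS]addrA; congr (_ + (_ + _)).
- by under eq_bigr do rewrite mulr0 (addchar0 cF); rewrite sumr_const.
- rewrite /gauss mulr_sumr; apply: eq_bigr => y _; rewrite -(addcharD cF).
  by congr addchar; ring.
- rewrite /gauss mulr_sumr; apply: eq_bigr => y _; rewrite -(addcharD cF).
  by congr addchar; ring.
Qed.

Section HermitianSum.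
Variables (F : finFieldType) (n m : nat) (lam : F).
Let q := (3 ^ n)%N.
Hypotheses (n_gt0 : (0 < n)%N) (m_gt0 : (0 < m)%N).
Hypothesis cardF : #|F| = (q ^ (2 * m))%N.
Hypotheses (lam_neq0 : lam != 0) (lam_frob : lam ^+ q = - lam).

Definition hsum : algC := \sum_t addchar (lam * t ^+ q.+1).

Let cF : #|F| = (3 ^ (n * (2 * m)))%N. Proof. by rewrite cardF /q -expnM. Qed.

Let q_gt1 : (1 < q)%N. Proof. by rewrite /q -{1}(expn0 3) ltn_exp2l. Qed.

Lemma hform_frob (t : F) : (lam * t ^+ q.+1) ^+ q = - (lam * (t ^+ q) ^+ q.+1).
Proof. by rewrite exprMn lam_frob mulNr -!exprM mulnC. Qed.

(** The substitution t -> t^q negates the form up to a Frobenius, so the sum equals its complex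
    conjugate and its square is a sum over differences of values of the form. *)
Lemma hsumN : \sum_t addchar (- (lam * t ^+ q.+1)) = hsum.
Proof.
rewrite (reindex_inj (exp3_inj cF (i := n))); apply: eq_bigr => t _.
by rewrite /= -/q -hform_frob (addchar_frob cF).
Qed.

Lemma card_exp3_fixed : #|[set w : F | w ^+ (q ^ 2) == w]| = (q ^ 2)%N.
Proof.
have sz : size ('X^(q ^ 2) - 'X : {poly F}) = (q ^ 2).+1.
  rewrite size_polyDl size_polyXn // size_polyN size_polyX ltnS.
  by have := q_gt1; nia.
have := @card_roots_dvd_genPoly F ('X^(q ^ 2) - 'X); rewrite sz /= => h.
rewrite -[RHS]h; first by apply: eq_card => x; rewrite !inE rootE !hornerE subr_eq0.
have -> : (q ^ 2 = 3 ^ (n * 2))%N by rewrite expnM.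
have -> : (#|F| = (3 ^ (n * 2)) ^ m)%N by rewrite cF -expnM mulnA.
by apply: dvdp_XexpX; exact: pchar3 cF.
Qed.

(* The radical of the form is the subfield of order q^2, on which it vanishes. *)
Lemma hsum_sqr : hsum ^+ 2 = (q ^ (2 * m))%:R * (q ^ 2)%:R.
Proof.
rewrite expr2 -{2}hsumN /hsum mulr_sumr.
transitivity (\sum_(u : F) \sum_(w : F) addchar (lam * w ^+ q.+1) *
   addchar (lam * (w - w ^+ (q ^ 2)) * u ^+ q)).
  apply: eq_bigr => u _; rewrite mulr_suml (reindex_inj (addrI u)).
  apply: eq_bigr => w _; rewrite -!(addcharD cF).
  have -> : lam * (u + w) ^+ q.+1 - lam * u ^+ q.+1 =
     lam * w ^+ q.+1 + lam * w * u ^+ q + lam * w ^+ q * u.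
    by rewrite exprSr /q (expD3 cF) -/q [w ^+ q.+1]exprSr [u ^+ q.+1]exprSr; ring.
  (* The second cross term is raised to the power q, which gives - lam w^(q^2) u^q, so that both
     cross terms become multiples of u^q and orthogonality in u applies. *)
  rewrite [LHS](addcharD cF) -(addchar_frob cF n (lam * w ^+ q * u)) -/q !exprMn.
  rewrite lam_frob -exprM -(addcharD cF); congr addchar.
  by rewrite -[(q * q)%N]/(q ^ 2)%N; ring.
rewrite exchange_big /=.
transitivity (\sum_(w : F) if w ^+ (q ^ 2) == w then (q ^ (2 * m))%:R else 0 : algC).
  apply: eq_bigr => w _; rewrite -mulr_sumr (sum_addchar_exp3 cF) cardF.
  rewrite mulf_eq0 (negPf lam_neq0) subr_eq0 eq_sym /=.
  case: eqP => [h|]; last by rewrite mulr0.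
  suff -> : addchar (lam * w ^+ q.+1) = 1 by rewrite mul1r.
  (* For w in the subfield of order q^2, the q-th power of lam w^(q+1) is its negative, so the
     character takes the same value at both. *)
  apply: (addchar_even cF).
  rewrite -[RHS](addchar_frob cF n) hform_frob; congr addchar; congr (- (_ * _)).
  by rewrite -exprM mulnS exprD -[(q * q)%N]/(q ^ 2)%N h exprSr.
by rewrite -big_mkcond sumr_const -[LHS]mulr_natr -[in RHS]card_exp3_fixed cardsE.
Qed.

(* The form is invariant under the (q+1)-th roots of unity; this fixes the sign of
   [hsum], an integer with known square. *)
Lemma dvdn_card_hform (C : pred F) :
  (q.+1 %| #|[set t : F | (t != 0%R) && C (t ^+ q.+1)%R]|)%N.
Proof.
rewrite -sum1_card (partition_big (fun t => t ^+ q.+1) predT) //=.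
apply: dvdn_sum => z _; rewrite sum1dep_card.
have [t0 /=|no] := pickP (fun t : F => [&& t != 0, C (t ^+ q.+1) & t ^+ q.+1 == z]);
  last first.
  rewrite (_ : #|_| = 0%N) // -(cards0 F); apply: eq_card => t; rewrite !inE.
  by rewrite -andbA no.
case/and3P => t00 Ct0 /eqP tz.
have d1 : (q.+1 %| #|F|.-1)%N.
  rewrite cardF expnM predn_exp; apply: dvdn_mulr.
  by apply/dvdnP; exists q.-1; have := q_gt1; nia.
rewrite (_ : #|_| = q.+1) //.
rewrite -[RHS](@card_roots_Xn F q.+1 z) //; last first.
  rewrite -tz -exprM mulnC divnK //; apply: (mulfI t00); rewrite mulr1 -exprS.
  by rewrite prednK ?expf_card // ltnW ?finNzRing_gt1.
apply: eq_card => t; rewrite !inE; case: eqVneq => [->|_] /=.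
  by rewrite expr0n /= -tz eq_sym expf_eq0 (negPf t00) andbF.
by case: eqP => [->|]; rewrite ?andbF // -tz Ct0.
Qed.

(** Sort the nonzero t by the trace of the form. The values 1 and -1 occur equally often, by t ->
    t^q, so omega and omega^2 combine to -1; all the counts are multiples of q + 1; t = 0
    contributes the leading 1. *)
Lemma hsum_int : exists z : int, hsum = 1 + (q.+1)%:R * z%:~R.
Proof.
pose N (e : F) := #|[set t : F | (t != 0) && (ftrace (lam * t ^+ q.+1) == e)]|.
have fr t : ftrace (lam * (t ^+ q) ^+ q.+1) = - ftrace (lam * t ^+ q.+1).
  rewrite -[X in ftrace X]opprK -hform_frob (ftraceN cF); congr (- _).
  exact: (ftrace_exp3 cF).
have N12 : N (-1) = N 1.
  rewrite /N -(card_imset _ (exp3_inj cF (i := n))).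
  apply: eq_card => t; rewrite !inE.
  apply/imsetP/andP => [[u]|[t0 /eqP ht]].
    rewrite inE => /andP[u0 /eqP hu] ->; rewrite expf_neq0 //; split => //.
    by rewrite fr hu opprK.
  have : t \in codom (fun x : F => x ^+ (3 ^ n)).
    exact: (injF_onto (exp3_inj cF (i := n))).
  case/codomP => u tu; exists u => //; rewrite inE.
  have u0 : u != 0 by apply: contra t0 => /eqP u0; rewrite tu u0 expr0n expn_eq0.
  by rewrite u0 /= -[ftrace _]opprK -fr -/q /q -tu ht.
have dN e : (q.+1 %| N e)%N.
  exact: (dvdn_card_hform (fun z => ftrace (lam * z) == e)).
have hE : hsum = 1 + (N 0)%:R - (N 1)%:R.
  rewrite /hsum (bigD1 0) //= expr0n mulr0 (addchar0 cF) -addrA; congr (_ + _).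
  have -> : \sum_(t : F | t != 0) addchar (lam * t ^+ q.+1) =
     (N 0)%:R + (N 1)%:R * omega + (N (-1))%:R * omega ^+ 2.
    rewrite /N -!sum1dep_card !natr_sum !mulr_suml.
    rewrite !(big_mkcond (fun t : F => (t != 0) && _)) /= big_mkcond -!big_split /=.
    apply: eq_bigr => t _; case: (t != 0) => /=; last by rewrite !addr0.
    have ne : (-1 == 1 :> F) = false := neg1_neq1 cF.
    have oo : (-1 == 0 :> F) = false by rewrite oppr_eq0 oner_eq0.
    rewrite /addchar /chi3; case: (ftrace_cases cF (lam * t ^+ q.+1)) => ->;
      rewrite ?eqxx ?[0 == _]eq_sym ?[1 == -1]eq_sym ?oner_eq0 ?ne ?oo;
      by rewrite ?(mul1r, add0r, addr0).
  have -> : omega ^+ 2 = - 1 - omega.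
    by rewrite -[LHS]addr0 -{1}(subrr (1 + omega)) addrA [_ + (1 + _)]addrC omega_sum; ring.
  by rewrite N12; ring.
case/dvdnP: (dN 0) hE => a ->; case/dvdnP: (dN 1) => a' -> ->.
by exists (a%:Z - a'%:Z); rewrite rmorphB /= -!pmulrn !natrM; ring.
Qed.

(** By [hsum_sqr] the sum is (-q)^(m+1) up to sign, and (-q)^(m+1) is 1 modulo q + 1, as is [hsum].
    The wrong sign would make q + 1 divide 2. *)
Lemma hsumE : hsum = (-1) ^+ m.+1 * q%:R ^+ m.+1.
Proof.
have [z hz] := hsum_int.
have : (hsum - (-1) ^+ m.+1 * q%:R ^+ m.+1) * (hsum + (-1) ^+ m.+1 * q%:R ^+ m.+1) = 0.
  transitivity (hsum ^+ 2 - ((-1) ^+ m.+1) ^+ 2 * (q%:R ^+ m.+1) ^+ 2); first by ring.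
  have -> : ((-1) ^+ m.+1) ^+ 2 = 1 :> algC by rewrite -exprM mulnC exprM sqrrN !expr1n.
  rewrite hsum_sqr mul1r (natrX _ q (2 * m)) (natrX _ q 2) -exprD -exprM.
  have -> : (2 * m + 2 = m.+1 * 2)%N by lia.
  by rewrite subrr.
move/eqP; rewrite mulf_eq0 => /orP[]; first by rewrite subr_eq0 => /eqP.
rewrite addr_eq0 => /eqP hneg; exfalso.
have : 1 + (q.+1)%:Z * z = - ((-1) ^+ m.+1 * q%:Z ^+ m.+1).
  apply: (@intr_inj algC); rewrite rmorphD rmorphM rmorphN rmorphM !rmorphXn /=.
  by rewrite rmorphN1 -!pmulrn -hz hneg.
have [y hy] : exists y : int, (-1) ^+ m.+1 * q%:Z ^+ m.+1 = 1 + (q.+1)%:Z * y.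
  rewrite -exprMn mulN1r; elim: (m.+1) => [|i [y hy]]; first by exists 0; rewrite mulr0 addr0.
  by exists (- 1 - q%:Z * y); rewrite exprS hy -addn1 PoszD; ring.
rewrite hy => h.
have q3 : (2 < q)%N by rewrite /q -(prednK n_gt0) expnS; have := expn_gt0 3 n.-1; lia.
have : (q.+1)%:Z * (z + y) = -2.
  have -> : (q.+1)%:Z * (z + y) = (1 + (q.+1)%:Z * z) + (1 + (q.+1)%:Z * y) - 2 by ring.
  by rewrite h; ring.
move: (q) (z + y) q3 => Q x Q3.
have [x0|x0] : (x <= 0) \/ (1 <= x) by lia.
  have [->|x1] : x = 0 \/ x <= -1 by lia.
    by rewrite mulr0.
  nia.
nia.
Qed.

End HermitianSum.

(** F is the splitting field of X^N - X. The roots are the fixed points of the m-th power of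
    Frobenius, hence form a subfield, hence fill F. A minimal polynomial over k has degree dividing
    [F : k] = m; it is the place below t. *)
Lemma finField_extension (k : finFieldType) (m : nat) : (0 < m)%N ->
  exists (F : finFieldType) (j : {rmorphism k -> F}), #|F| = (#|k| ^ m)%N /\
    forall t : F, exists p : {poly k}, [/\ monic_irreducible_poly p,
      root (map_poly j p) t & ((size p).-1 %| m)%N].
Proof.
move=> m_gt0; set N := (#|k| ^ m)%N.
have N_gt1 : (1 < N)%N.
  by rewrite -(exp1n m) ltn_exp2r // finNzRing_gt1.
have szP (R : nzRingType) : size ('X^N - 'X : {poly R}) = N.+1.
  by rewrite size_polyDl size_polyXn // size_polyN size_polyX.
have nzP : 'X^N - 'X != 0 :> {poly k} by rewrite -size_poly_eq0 szP.
have [L [zs splitL genL]] := FinSplittingFieldFor nzP.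
rewrite /= rmorphB /= map_polyXn map_polyX in splitL.
pose F := FinFieldExtType L.
have Nk0 : N%:R = 0 :> L.
  have /(congr1 (in_alg L)) : #|k|%:R = 0 :> k.
    (* Translation by 1 permutes k, so |k| copies of 1 sum to 0. The derivative of X^N - X is
       therefore -1 and its roots are simple. *)
    have h : \sum_(x : k) x = \sum_(x : k) (1 + x) by rewrite (reindex_inj (addrI 1)).
    by apply: (addIr (\sum_(x : k) x)); rewrite add0r {2}h big_split /= sumr_const.
  rewrite rmorph_nat rmorph0 => k0.
  by rewrite natrX k0 expr0n eqn0Ngt m_gt0.
have uzs : uniq zs.
  rewrite -separable_prod_XsubC -(eqp_separable splitL) separable_poly.unlock derivB.
  rewrite derivX derivXn -mulr_natr -polyC_natr Nk0 mulr0 sub0r.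
  by rewrite coprimep_sym -scaleN1r coprimepZl ?oppr_eq0 ?oner_eq0 ?coprime1p.
have [a _ Da] := finField_galois_generator (sub1v {:L}%AS).
rewrite dimv1 expn1 in Da.
have DaN i x : (a ^+ i)%g x = x ^+ (#|k| ^ i).
  elim: i => [|i IHi]; first by rewrite gal_id expn0 expr1.
  by rewrite expgSr expnSr exprM galM ?memvf // IHi Da ?memvf.
have zsE : zs =i fixedSpace (a ^+ m)%g.
  move=> z; rewrite -root_prod_XsubC -(eqp_root splitL) (sameP fixedSpaceP eqP).
  by rewrite rootE !hornerE subr_eq0 DaN.
have allz (x : L) : x \in zs.
  rewrite zsE; suff -> : fixedSpace (a ^+ m)%g = {:L}%VS by rewrite memvf.
  apply/eqP; rewrite eqEsubv subvf -genL -[X in (_ <= X)%VS]subfield_closed.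
  by apply: agenvS; rewrite subv_add sub1v; apply/span_subvP => z; rewrite zsE.
have cF : #|F| = N.
  have /eq_card-> : F =i zs by move=> x; rewrite (allz x).
  apply: succn_inj; rewrite (elimT (@card_uniqP F zs) uzs) -(size_prod_XsubC zs id).
  by rewrite -(eqp_size splitL) szP.
have dimL : \dim {:L} = m.
  have := @card_vspace k F (Vector.class (L : vectType k)) fullv.
  rewrite card_vspacef cF => /eqP; rewrite eqn_exp2l ?finNzRing_gt1 //.
  by move/eqP.
exists F, (in_alg L); split => // t.
have /polyOver1P[p pE] := minPolyOver 1%AS (t : L).
have sp : size p = (adjoin_degree 1%AS (t : L)).+1.
  by rewrite -(size_map_poly (in_alg L)) -pE size_minPoly.
have pm : p \is monic.
  by rewrite -(map_monic (in_alg L)) -pE monic_minPoly.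
exists p; split.
- split => //; split; first by rewrite sp.
  move=> r sr rp; have := @minPoly_irr _ _ 1%AS (t : L) (map_poly (in_alg L) r).
  rewrite pE dvdp_map rp => /(_ (alg_polyOver _ _) isT); rewrite eqp_map => /orP[//|].
  by rewrite -size_poly_eq1 size_map_poly (negPf sr).
- by rewrite -[map_poly _ p]pE root_minPoly.
rewrite sp /= -dimL; apply: dvdn_trans (field_dimS (subvf <<1; (t : L)>>%AS)).
by rewrite dim_Fadjoin dimv1 muln1.
Qed.

(** * Sums over places *)

Section PlaceReduction.
Variables (k : finFieldType) (p : finite_place k).

(** The reduction hidden in [reduce_at], named with codomain [residue_field] so that it can carry a
    ring morphism structure. *)
Definition polyred (g : {poly k}) : residue_field (Some p) := in_qpoly (sval p) g.

Lemma polyred_zmod_morphism : zmod_morphism polyred.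
Proof. by move=> f g; rewrite /polyred; exact: (rmorphB (in_qpoly (sval p))). Qed.

Lemma polyred_monoid_morphism : monoid_morphism polyred.
Proof.
by split=> [|f g]; [exact: (rmorph1 (in_qpoly _)) | exact: (rmorphM (in_qpoly _))].
Qed.

HB.instance Definition _ :=
  GRing.isZmodMorphism.Build _ _ polyred polyred_zmod_morphism.
HB.instance Definition _ :=
  GRing.isMonoidMorphism.Build _ _ polyred polyred_monoid_morphism.

Lemma place_irr : irreducible_poly (sval p).
Proof. by have [] := finite_place_irreducible p. Qed.

Lemma place_monic : sval p \is monic.
Proof. by have [] := finite_place_irreducible p. Qed.

Lemma place_deg_gt0 : (0 < place_deg (Some p))%N.
Proof. by rewrite /place_deg -subn1 subn_gt0; case: place_irr. Qed.

Lemma polyred_eq0 g : (polyred g == 0) = (sval p %| g).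
Proof.
have mi := finite_place_irreducible p.
rewrite /polyred -[LHS]val_eqE /=.
by rewrite -Pdiv.IdomainMonic.modpE ?mk_monicE // place_monic.
Qed.

Lemma polyred_eq f g : (polyred f == polyred g) = (sval p %| f - g).
Proof. by rewrite -subr_eq0 -rmorphB polyred_eq0. Qed.

Lemma card_residue_field_Some :
  #|residue_field (Some p)| = (#|k| ^ place_deg (Some p))%N.
Proof. exact: card_residue_field. Qed.

Lemma place_dvd_genPoly : sval p %| 'X^(#|k| ^ place_deg (Some p)) - 'X.
Proof.
by rewrite -polyred_eq rmorphXn /= -card_residue_field_Some expf_card.
Qed.

End PlaceReduction.

Definition place_char (k : finFieldType) (g : {poly k}) (p : finite_place k) : algC :=
  addchar (polyred p g).

Section PlaceSum.
Variables (k F : finFieldType) (j : {rmorphism k -> F}) (r m : nat).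
Hypotheses (cardk : #|k| = (3 ^ r)%N) (m_gt0 : (0 < m)%N).
Hypothesis cardF : #|F| = (#|k| ^ m)%N.

Let cF : #|F| = (3 ^ (r * m))%N. Proof. by rewrite cardF cardk expnM. Qed.

Let r_gt0 : (0 < r)%N.
Proof.
by rewrite lt0n; apply: contraTneq (finNzRing_gt1 k) => h; rewrite cardk h.
Qed.

Lemma card_place_roots (p : finite_place k) : (place_deg (Some p) %| m)%N ->
  #|[set t | root (map_poly j (sval p)) t]| = place_deg (Some p).
Proof.
move=> /dvdnP[e me]; rewrite card_roots_dvd_genPoly ?size_map_poly //.
have -> : 'X^#|F| - 'X = map_poly j ('X^#|F| - 'X).
  by rewrite rmorphB /= map_polyXn map_polyX.
rewrite dvdp_map; apply: dvdp_trans (place_dvd_genPoly p) _.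
have -> : #|F| = ((3 ^ (r * place_deg (Some p))) ^ e)%N.
  by rewrite cF me -expnM -mulnA [(e * _)%N]mulnC.
rewrite cardk -expnM.
by apply: dvdp_XexpX; exact: pchar3 cardk.
Qed.

Lemma root_place_eq (p p' : finite_place k) t :
  root (map_poly j (sval p)) t -> root (map_poly j (sval p')) t -> p = p'.
Proof.
move=> h h'; apply: val_inj => /=.
have dv : sval p %| sval p'.
  rewrite -[_ %| _]negbK -irreducible_poly_coprime; last exact: place_irr.
  rewrite -(coprimep_map j); apply/negP => /coprimep_root/(_ h).
  by move: h'; rewrite rootE => ->.
have : sval p %= sval p'.
  apply: (apply_irredp (place_irr p')) => //.
  by have [h1 _] := place_irr p; rewrite neq_ltn h1 orbT.
by rewrite eqp_monic ?place_monic // => /eqP.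
Qed.

(** Evaluation at t embeds the residue field at p in F, and over F the trace of an element of this
    subfield is m / d times its trace over the subfield. *)
Lemma addchar_place (g : {poly k}) (p : finite_place k) t :
  root (map_poly j (sval p)) t -> (place_deg (Some p) %| m)%N ->
  addchar (map_poly j g).[t] = place_char g p ^+ (m %/ place_deg (Some p)).
Proof.
move=> pt dm; set d := place_deg _ in dm *; set e := (m %/ d)%N.
have ev0 f : sval p %| f -> (map_poly j f).[t] = 0.
  case/dvdpP => h ->; rewrite rmorphM /= hornerM.
  by move: pt; rewrite rootE => /eqP ->; rewrite mulr0.
have evE f f' : polyred p f = polyred p f' -> (map_poly j f).[t] = (map_poly j f').[t].
  move/eqP; rewrite polyred_eq => /ev0; rewrite rmorphB /= hornerD hornerN.
  by move/eqP; rewrite subr_eq0 => /eqP.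
have cp : #|residue_field (Some p)| = (3 ^ (r * d))%N.
  by rewrite card_residue_field_Some cardk expnM.
set v := (map_poly j g).[t].
have vX i : v ^+ i = (map_poly j (g ^+ i)).[t] by rewrite rmorphXn /= horner_exp.
have vd : v ^+ (3 ^ (r * d)) = v.
  by rewrite vX; apply: evE; rewrite rmorphXn /= -cp expf_card.
(* The trace of g is written as a polynomial A, which can be both reduced at p and evaluated at t.
   This transports the trace value 0, 1 or -1 without constructing the embedding. *)
pose A : {poly k} := \sum_(i < r * d) g ^+ (3 ^ i).
have Ared : polyred p A = ftrace (polyred p g).
  by rewrite (ftraceE cp) rmorph_sum; apply: eq_bigr => i _; rewrite rmorphXn.
have Aev : (map_poly j A).[t] = \sum_(i < r * d) v ^+ (3 ^ i).
  by rewrite rmorph_sum horner_sum; apply: eq_bigr => i _; rewrite vX.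
have trv : ftrace v = (map_poly j A).[t] *+ e.
  rewrite (ftraceE cF) Aev.
  have -> : (r * m = e * (r * d))%N by rewrite mulnCA divnK.
  elim: (e) => [|i IH]; first by rewrite mul0n big_ord0 mulr0n.
  rewrite mulSn big_split_ord /= mulrS; congr (_ + _).
  rewrite -[RHS]IH; apply: eq_bigr => l _.
  by rewrite expnD exprM vd.
have chi_eq : chi3 (map_poly j A).[t] = place_char g p.
  rewrite /place_char /addchar -Ared.
  have := ftrace_cases cp (polyred p g); rewrite -Ared.
  have evC c : polyred p A = polyred p c%:P -> (map_poly j A).[t] = j c.
    by move/evE => ->; rewrite map_polyC hornerC.
  case=> h; rewrite h.
  - by rewrite (evC 0) ?h ?rmorph0 // /chi3 !eqxx.
  - by rewrite (evC 1) ?h ?rmorph1 // /chi3 !eqxx !oner_eq0.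
  - rewrite (evC (-1)) ?h ?rmorphN ?rmorph1 // /chi3 !oppr_eq0 !oner_eq0.
    by rewrite (neg1_neq1 cF) (neg1_neq1 cp).
rewrite /addchar trv (chi3Mn cF) ?chi_eq //.
have -> : (map_poly j A).[t] ^+ 3 = (map_poly j (A ^+ 3)).[t].
  by rewrite rmorphXn /= horner_exp.
by apply: evE; rewrite rmorphXn /= Ared (ftrace_cube cp).
Qed.

(** Elements of F are grouped by minimal polynomial: a place of degree d dividing m owns d of them,
    on which the summand is constant. *)
Lemma sum_addchar_places (g : {poly k}) (s : seq (finite_place k)) :
  (forall t : F, exists p : {poly k}, [/\ monic_irreducible_poly p,
      root (map_poly j p) t & ((size p).-1 %| m)%N]) ->
  uniq s -> (forall p, (place_deg (Some p) <= m)%N -> p \in s) ->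
  \sum_t addchar (map_poly j g).[t] =
  \sum_(p <- s | (place_deg (Some p) %| m)%N)
    (place_deg (Some p))%:R * place_char g p ^+ (m %/ place_deg (Some p)).
Proof.
move=> ext us ins.
transitivity (\sum_(p <- s | (place_deg (Some p) %| m)%N)
   \sum_(t | root (map_poly j (sval p)) t) addchar (map_poly j g).[t]); last first.
  apply: eq_bigr => p dp.
  rewrite (eq_bigr (fun=> place_char g p ^+ (m %/ place_deg (Some p)))); last first.
    by move=> t pt; exact: addchar_place.
  rewrite sumr_const mulr_natl; congr (_ *+ _); rewrite -[RHS](card_place_roots dp).
  by apply: eq_card => t; rewrite !inE.
rewrite (exchange_big_dep predT) //=; apply: eq_bigr => t _.
have [p [mi pt dm]] := ext t.
have pP : (p \is monic) && irreducibleb p by rewrite mi; apply/irreducibleP; case: mi.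
pose P : finite_place k := exist _ p pP.
have Ps : P \in s by apply: ins; exact: dvdn_leq.
rewrite big_mkcond (bigD1_seq P) //= dm pt /= big1 ?addr0 // => p' ne.
by case: ifP => // /andP[_ h]; case/eqP: ne; exact: (@root_place_eq p' P t h pt).
Qed.

End PlaceSum.

(** * Euler products *)

Lemma dvdp_XnP (R : fieldType) n (p : {poly R}) :
  reflect (forall i, (i < n)%N -> p`_i = 0) ('X^n %| p).
Proof.
apply: (iffP idP) => [/dvdpP[u ->] i iN|h]; first by rewrite coefMXn iN.
rewrite -(poly_take_drop n p) (_ : take_poly n p = 0) ?add0r ?dvdp_mull //.
by apply/polyP => i; rewrite coef_take_poly coef0; case: ifP => // /h.
Qed.

Section LogDerivative.
Variables (R : numFieldType) (I : Type) (d : I -> nat) (c : I -> R) (N : nat).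

Definition euler_factor (i : I) : {poly R} := 1 - c i *: 'X^(d i).

Definition power_sum (s : seq I) (m : nat) : R :=
  \sum_(i <- s | (d i %| m)%N) (d i)%:R * c i ^+ (m %/ d i).

(** The constant term is forced to 0: [power_sum s 0] would be the sum of all d i, whereas -X A'/A
    has no constant term. *)
Definition power_series (S : nat -> R) : {poly R} := \poly_(m < N.+1) (if m is 0 then 0 else S m).

(** The identity -X f'/f = sum over j >= 1 of d c^j X^(dj) for f = 1 - c X^d, cleared of its
    denominator and truncated. *)
Lemma euler_factor_logderiv i : (0 < d i)%N ->
  'X^(N.+1) %| 'X * (euler_factor i)^`() + euler_factor i * power_series (power_sum [:: i]).
Proof.
move=> d0; apply/dvdp_XnP => m mN.
rewrite coefD coefXM; set f := euler_factor i.
have fE l : f`_l.+1 = - (c i * (l.+1 == d i)%:R).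
  by rewrite /f coefB coef1 coefZ coefXn sub0r.
case: m mN => [|m] mN.
  by rewrite /= add0r coef0M [_`_0 in X in _ * X]coef_poly mulr0.
rewrite /= coef_deriv fE /f mulrBl mul1r -scalerAl coefB coefZ coefXnM !coef_poly mN.
rewrite /power_sum big_cons big_nil.
have [lt|gt|eq] := ltngtP m.+1 (d i).
- by rewrite gtnNdvd // ?mulr0 ?oppr0 ?mul0rn ?add0r ?subr0.
- have [l lE] : exists l, (m.+1 = l.+1 + d i)%N by exists (m - d i)%N; lia.
  have lN : (l.+1 < N.+1)%N by lia.
  rewrite lE addnK lN big_cons big_nil dvdn_addl ?dvdnn //.
  rewrite divnDr // divnn d0 addn1 mulr0 oppr0 mul0rn add0r.
  by case: ifP => _; rewrite ?addr0 ?mulr0 ?subr0 // exprS; ring.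
- rewrite eq subnn ltn0Sn dvdnn divnn d0 !mulr0 addr0 mulr1 expr1 subr0.
  by rewrite -mulr_natl; ring.
Qed.

Lemma euler_product_logderiv (s : seq I) : (forall i, (0 < d i)%N) ->
  let A := \prod_(i <- s) euler_factor i in
  'X^(N.+1) %| 'X * A^`() + A * power_series (power_sum s).
Proof.
move=> d0 /=; elim: s => [|i s IH].
  rewrite big_nil -polyC1 derivC mulr0 add0r polyC1 mul1r; apply/dvdp_XnP => m mN.
  by rewrite coef_poly mN; case: m {mN} => // m; rewrite /power_sum big_nil.
rewrite big_cons; set f := euler_factor i; set A := \prod_(_ <- _) _ in IH *.
have -> : power_series (power_sum (i :: s)) =
    power_series (power_sum [:: i]) + power_series (power_sum s).
  apply/polyP => m; rewrite coefD !coef_poly; case: ifP => // _; rewrite ?addr0 //.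
  case: m => [|m]; first by rewrite addr0.
  by rewrite /power_sum !big_cons big_nil; case: ifP; rewrite ?add0r ?addr0.
rewrite derivM; have := euler_factor_logderiv (d0 i); rewrite -/f => hf.
set Hi := power_series _ in hf *; set Hs := power_series _ in IH *.
have -> : 'X * (f^`() * A + f * A^`()) + f * A * (Hi + Hs) =
   A * ('X * f^`() + f * Hi) + f * ('X * A^`() + A * Hs) by ring.
by rewrite dvdp_add // dvdp_mull.
Qed.

(** With L = 1 + qX, the prescribed power sums form the series H = q^2 X / L, while B = L^q
    satisfies X B' = (q^2 X / L) B. Since X A' = - A H, the derivative of A B vanishes to the given
    order, and in characteristic 0 this leaves the constant term 1. *)
Lemma euler_product_eq (s : seq I) (q : nat) : (forall i, (0 < d i)%N) -> (0 < q)%N ->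
  (forall m, (0 < m <= N)%N -> power_sum s m = (-1) ^+ m.+1 * q%:R ^+ m.+1) ->
  'X^(N.+1) %| \prod_(i <- s) euler_factor i * (1 + q%:R *: 'X) ^+ q - 1.
Proof.
move=> d0 q0 hS; have /= hA := euler_product_logderiv s d0.
set A := \prod_(_ <- _) _ in hA *.
set H := power_series _ in hA.
pose L : {poly R} := 1 + q%:R *: 'X.
have L0 : L`_0 = 1 by rewrite coefD coef1 coefZ coefX mulr0 addr0.
have hH : 'X^(N.+1) %| H * L - (q ^ 2)%:R *: 'X.
  apply/dvdp_XnP => m mN; rewrite mulrDr mulr1 -scalerAr !(coefD, coefN, coefZ) coefMX coefX.
  rewrite /H !coef_poly mN.
  case: m mN => [|[|m]] mN; rewrite ?mulr0 ?subr0 ?addr0 //=.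
    by rewrite hS // expr2 mulrNN mulr1 mul1r mulr1 natrX subrr.
  rewrite (ltnW mN) !hS; [by rewrite !exprS; ring | exact: ltnW | by []].
pose B := L ^+ q.
have hB : 'X * B^`() * L = (q ^ 2)%:R *: 'X * B.
  rewrite /B -{1 3}(prednK q0) deriv_exp /= exprS /L derivD -polyC1 derivC add0r derivZ derivX.
  rewrite prednK // polyC1 -!mul_polyC natrX -mulr_natl -polyC_natr !polyCM; ring.
have hD : 'X^(N.+1) %| 'X * (A * B)^`() * L.
  have -> : 'X * (A * B)^`() * L = B * L * ('X * A^`() + A * H)
      - A * B * (H * L - (q ^ 2)%:R *: 'X).
    transitivity ('X * A^`() * B * L + A * ('X * B^`() * L)).
      by rewrite derivM; ring.
    by rewrite hB; ring.
  by rewrite dvdp_sub // dvdp_mull.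
(* L has constant term 1, so it can be cancelled modulo X^(N+1). *)
have cop : coprimep ('X^(N.+1)) L.
  by rewrite coprimep_expl // coprimep_sym coprimepX rootE horner_coef0 L0 oner_eq0.
have hD' : 'X^(N.+1) %| 'X * (A * B)^`() by rewrite -(Gauss_dvdpl _ cop).
apply/dvdp_XnP => m mN; rewrite coefB coef1.
case: m mN => [|m] mN.
  rewrite -/L -/B coef0M -!horner_coef0 horner_exp horner_prod big1.
    by rewrite mul1r horner_coef0 L0 expr1n subrr.
  move=> i _; rewrite /euler_factor !hornerE expr0n.
  by rewrite eqn0Ngt d0 /= mulr0 subr0.
have /dvdp_XnP/(_ _ mN) := hD'; rewrite coefXM /= coef_deriv subr0 => /eqP.
by rewrite mulrn_eq0 /= => /eqP.
Qed.

End LogDerivative.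

Lemma dvdp_Xn_comp_scale (R : fieldType) n (c : R) (p : {poly R}) :
  'X^n %| p -> 'X^n %| p \Po (c *: 'X).
Proof.
case/dvdpP => u ->; rewrite comp_polyM rmorphXn /= comp_polyX exprZn.
by rewrite -scalerAr -mul_polyC mulrA dvdp_mull.
Qed.

Lemma comp_poly_prod (R : comNzRingType) I (s : seq I) (f : I -> {poly R}) u :
  (\prod_(i <- s) f i) \Po u = \prod_(i <- s) (f i \Po u).
Proof. exact: rmorph_prod. Qed.

Lemma comp_poly_exp (R : comNzRingType) (p u : {poly R}) n :
  (p ^+ n) \Po u = (p \Po u) ^+ n.
Proof. exact: rmorphXn. Qed.

Lemma euler_factor_comp (R : numFieldType) I (d : I -> nat) (c : I -> R) i x :
  euler_factor d c i \Po (x *: 'X) = 1 - (c i * x ^+ d i) *: 'X^(d i).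
Proof.
rewrite /euler_factor comp_polyB comp_polyZ -polyC1 comp_polyC comp_poly_exp.
by rewrite comp_polyX exprZn scalerA.
Qed.

(** With x = q and v = u^-1 a value of the character, the right side is the shape of a local factor
    of good reduction: trace (-q)^d (u + u^-1) and norm q^(2d) = |k|^d. *)
Lemma euler_factor_pair (R : numFieldType) (u v x : R) d : u * v = 1 ->
  (1 - (u * (- x) ^+ d) *: 'X^d) * (1 - (v * (- x) ^+ d) *: 'X^d) =
  1 - ((- x) ^+ d * (u + v)) *: 'X^d + (x ^+ (2 * d)) *: 'X^(2 * d).
Proof.
move=> uv; rewrite mulrBl mul1r mulrBr mulr1 -scalerAl -scalerAr scalerA -exprD.
rewrite addnn -mul2n.
have -> : u * (- x) ^+ d * (v * (- x) ^+ d) = x ^+ (2 * d).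
  by rewrite mulrACA uv mul1r -exprD addnn -mul2n 2!exprM sqrrN.
by rewrite mulrDr scalerDl [u * _]mulrC [v * _]mulrC; ring.
Qed.

Section PlaceEulerProduct.
Variables (k : finFieldType) (n N : nat) (s : seq (finite_place k)).
Let q := (3 ^ n)%N.
Hypotheses (n_gt0 : (0 < n)%N) (cardk : #|k| = (q ^ 2)%N).
Hypotheses (s_uniq : uniq s).
Hypothesis s_full : forall p, (place_deg (Some p) <= N)%N -> p \in s.

Definition hpoly (lam : k) : {poly k} := lam%:P * 'X^((3 ^ n).+1).

Let cardk3 : #|k| = (3 ^ (n * 2))%N. Proof. by rewrite cardk /q expnM. Qed.

Let q_gt0 : (0 < q)%N. Proof. by rewrite /q expn_gt0. Qed.

Lemma artin_schreier_Lfunction (lam : k) : lam != 0 -> lam ^+ q = - lam ->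
  'X^(N.+1) %| \prod_(p <- s) euler_factor (fun p => place_deg (Some p))
                  (place_char (hpoly lam)) p * (1 + q%:R *: 'X) ^+ q - 1.
Proof.
move=> l0 lq; apply: euler_product_eq => // [p|m /andP[m0 mN]].
  exact: place_deg_gt0.
have [F [j [cF ext]]] := finField_extension k m0.
have cF' : #|F| = (q ^ (2 * m))%N by rewrite cF cardk -expnM.
rewrite /power_sum -(@sum_addchar_places k F j (n * 2) m) //; last first.
  by move=> p pm; apply: s_full; apply: leq_trans pm mN.
rewrite -(@hsumE F n m (j lam)) //.
- by apply: eq_bigr => t _; rewrite rmorphM /= map_polyC map_polyXn !hornerE.
- by rewrite fmorph_eq0.
- by rewrite -rmorphXn -/q lq rmorphN.
Qed.

Lemma place_charN (lam : k) p :
  place_char (hpoly lam) p * place_char (hpoly (- lam)) p = 1.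
Proof.
have cp : #|residue_field (Some p)| = (3 ^ (n * 2 * place_deg (Some p)))%N.
  by rewrite card_residue_field_Some cardk3 -expnM.
by rewrite /place_char /hpoly polyCN mulNr rmorphN /= (addcharN cp).
Qed.

(** Product of the series for lam and - lam after the substitution U = - q T, which turns each (1 +
    q U)^q into (1 - q^2 T)^q. *)
Lemma euler_product_pair (lam : k) : lam != 0 -> lam ^+ q = - lam ->
  'X^(N.+1) %| \prod_(p <- s) (1 - ((- q%:R) ^+ place_deg (Some p) *
         (place_char (hpoly lam) p + place_char (hpoly (- lam)) p))
           *: 'X^(place_deg (Some p))
       + (q ^ (2 * place_deg (Some p)))%:R *: 'X^(2 * place_deg (Some p)))
     * (1 - (q ^ 2)%:R *: 'X) ^+ (2 * q) - (1 : {poly algC}).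
Proof.
move=> l0 lq.
have h1 := dvdp_Xn_comp_scale (- q%:R) (artin_schreier_Lfunction l0 lq).
have nl0 : - lam != 0 by rewrite oppr_eq0.
have nlq : (- lam) ^+ q = - - lam by rewrite /q (expN3 cardk3) -/q lq.
have h2 := dvdp_Xn_comp_scale (- q%:R) (artin_schreier_Lfunction nl0 nlq).
have comp1 (r : {poly algC}) : 1 \Po r = 1 by rewrite -polyC1 comp_polyC.
rewrite comp_polyB comp_polyM comp1 in h1; rewrite comp_polyB comp_polyM comp1 in h2.
set A1 := _ \Po _ in h1; set A2 := _ \Po _ in h2.
set B := _ \Po _ in h1 h2.
have BE : B = (1 - (q ^ 2)%:R *: 'X) ^+ q.
  rewrite /B comp_poly_exp comp_polyD comp_polyZ comp_polyX comp1.
  by rewrite scalerA mulrN scaleNr natrX -expr2.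
set P := \prod_(_ <- _) _.
have PE : P = A1 * A2.
  rewrite /A1 comp_poly_prod /A2 comp_poly_prod -big_split; apply: eq_bigr => p _.
  have e1 l := euler_factor_comp (fun p => place_deg (Some p)) (place_char (hpoly l)) p (- q%:R).
  apply: etrans (esym (congr2 *%R (e1 lam) (e1 (- lam)))).
  rewrite (euler_factor_pair _ _ (place_charN lam p)).
  rewrite (natrX _ q (2 * place_deg (Some p))) //.
have BB : (1 - (q ^ 2)%:R *: 'X) ^+ (2 * q) = B * B.
  by rewrite [RHS](congr2 *%R BE BE) -exprD addnn mul2n.
rewrite PE BB; clear - h1 h2; clearbody A1 A2 B.
have -> : A1 * A2 * (B * B) - 1 = (A1 * B - 1) * (A2 * B) + (A2 * B - 1) by ring.
by rewrite dvdp_add // dvdp_mulr.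
Qed.

End PlaceEulerProduct.

(** * Integral elements and reduction *)

(** The sizes are only bounds: at infinity the numerator may have smaller degree than the
    denominator, and its coefficient at the top position is then 0. *)
Lemma coefM_top (R : nzRingType) (a c : {poly R}) m n :
  (size a <= m.+1)%N -> (size c <= n.+1)%N -> (a * c)`_(m + n) = a`_m * c`_n.
Proof.
move=> sa sc; have mn : (m < (m + n).+1)%N by rewrite ltnS leq_addr.
rewrite coefM (bigD1 (Ordinal mn)) //= addKn big1 ?addr0 // => -[i /= im] ne.
have [lt|gt|eq] := ltngtP i m.
- by rewrite [c`__]nth_default ?mulr0 //; apply: leq_trans sc _; lia.
- by rewrite [a`__]nth_default ?mul0r //; apply: leq_trans sa _.
- by case/eqP: ne; apply: val_inj.
Qed.

Section Reduction.
Variable k : finFieldType.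
Local Notation K := {fraction {poly k}}.
Local Notation "x %:F" := (FracField.tofrac x).

Lemma frac_repr (x : K) : x = (\n_(repr x))%:F / (\d_(repr x))%:F.
Proof.
have d0 : (\d_(repr x))%:F != 0 by rewrite tofrac_eq0 denom_ratioP.
apply: (mulIf d0); rewrite divfK // -{1}[x]reprK.
unlock FracField.tofrac; rewrite -[LHS]FracField.pi_mul.
apply/eqmodP; rewrite /= FracField.equivfE /FracField.mulf.
rewrite !numden_Ratio ?oner_neq0 ?mulr1 ?denom_ratioP //.
by rewrite mulrC.
Qed.

Lemma fden_neq0 (x : K) : fden x != 0.
Proof.
by rewrite /fden dvdp_div_eq0 ?dvdp_gcdr ?denom_ratioP.
Qed.

Lemma fnum_fden (x : K) : x = (fnum x)%:F / (fden x)%:F.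
Proof.
set g := gcdp \n_(repr x) \d_(repr x).
have g0 : g != 0 by rewrite gcdp_eq0 negb_and denom_ratioP orbT.
have nE : (\n_(repr x))%:F = (fnum x)%:F * g%:F.
  by rewrite -rmorphM /= divpK // dvdp_gcdl.
have dE : (\d_(repr x))%:F = (fden x)%:F * g%:F.
  by rewrite -rmorphM /= divpK // dvdp_gcdr.
by rewrite [LHS]frac_repr nE dE -mulf_div divff ?mulr1 // tofrac_eq0.
Qed.

Lemma fnum_fden_coprime (x : K) : coprimep (fnum x) (fden x).
Proof. by rewrite coprimep_div_gcd // denom_ratioP orbT. Qed.

Lemma fnum_fden_cross (a b : {poly k}) : b != 0 ->
  fnum (a%:F / b%:F) * b = a * fden (a%:F / b%:F).
Proof.
move=> b0; set x := _ / _; have := fnum_fden x; rewrite {1}/x => /eqP.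
rewrite eqr_div ?tofrac_eq0 ?fden_neq0 // -!rmorphM /= tofrac_eq => /eqP <-.
by [].
Qed.

Lemma fden_dvd (a b : {poly k}) : b != 0 -> fden (a%:F / b%:F) %| b.
Proof.
move=> b0; set x := _ / _.
have c : coprimep (fden x) (fnum x) by rewrite coprimep_sym fnum_fden_coprime.
by rewrite -(Gauss_dvdpr _ c) fnum_fden_cross // dvdp_mull.
Qed.

Lemma fnum_eq0 (x : K) : (fnum x == 0) = (x == 0).
Proof.
rewrite {2}[x]fnum_fden mulf_eq0 invr_eq0 !tofrac_eq0.
by rewrite (negPf (fden_neq0 x)) orbF.
Qed.

Lemma fnum_inv (x : K) : x != 0 -> (fnum x^-1 %= fden x) && (fden x^-1 %= fnum x).
Proof.
move=> x0; have n0 : fnum x != 0 by rewrite fnum_eq0.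
have xE : x^-1 = (fden x)%:F / (fnum x)%:F by rewrite {1}[x]fnum_fden invf_div.
have cr := fnum_fden_cross (fden x) n0; rewrite -xE in cr.
have c := fnum_fden_coprime x; have c' := fnum_fden_coprime x^-1.
have h1 : fden x^-1 %| fnum x by rewrite xE fden_dvd.
have h2 : fnum x %| fden x^-1.
  by rewrite -(Gauss_dvdpr _ c) -cr dvdp_mull.
have h3 : fnum x^-1 %| fden x.
  by rewrite -(Gauss_dvdpl _ c') -cr dvdp_mulr.
have h4 : fden x %| fnum x^-1.
  by rewrite coprimep_sym in c; rewrite -(Gauss_dvdpl _ c) cr dvdp_mulr.
by rewrite /eqp h1 h2 h3 h4.
Qed.

Lemma pmult_eqp (p a b : {poly k}) : a %= b -> pmult p a = pmult p b.
Proof.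
move=> ab; rewrite /pmult (eqp_size ab); apply: eq_bigl => i.
by rewrite (eqp_dvdr _ ab).
Qed.

Lemma pmult_eq0 (p a : {poly k}) : ~~ (p %| a) -> pmult p a = 0%N.
Proof.
move=> na; apply/eqP; rewrite -leqn0; apply/bigmax_leqP => i.
by case: (nat_of_ord i) => // j; apply: contraLR => _; apply: contra na;
  apply: dvdp_trans; rewrite exprS dvdp_mulr.
Qed.

Lemma pmult_gt0 (p a : {poly k}) : (1 < size p)%N -> a != 0 -> p %| a ->
  (0 < pmult p a)%N.
Proof.
move=> sp a0 pa; have s1 : (1 < size a)%N by apply: leq_trans sp (dvdp_leq a0 pa).
by rewrite /pmult; apply: (@leq_bigmax_cond _ _ _ (Ordinal s1)); rewrite /= expr1.
Qed.

Lemma ordv_inv v (x : K) : x != 0 -> ordv v x^-1 = - ordv v x.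
Proof.
case/fnum_inv/andP => h1 h2; case: v => [p|] /=; last first.
  by rewrite (eqp_size h1) (eqp_size h2) opprB.
by rewrite (pmult_eqp _ h1) (pmult_eqp _ h2) opprB.
Qed.

(** A presentation a / b good enough for reducing at v, without being in lowest terms. Sums and
    products can thus be reduced on their evident presentations, although [fnum] and [fden] of the
    result depend on [repr]. *)
Definition fraction_at (v : place k) (a b : {poly k}) : bool :=
  if v is Some p then ~~ (sval p %| b) else (b != 0) && (size a <= size b)%N.

Definition fraction_red (v : place k) : {poly k} -> {poly k} -> residue_field v :=
  match v with
  | Some p => fun a b => polyred p a / polyred p b
  | None => fun a b => a`_(size b).-1 / lead_coef b
  end.

Lemma fraction_at_neq0 v a b : fraction_at v a b -> b != 0.
Proof. by case: v => [p /=|/andP[]//]; apply: contra => /eqP ->; rewrite dvdp0. Qed.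

Lemma integral_atE v (x : K) : integral_at v x = fraction_at v (fnum x) (fden x).
Proof.
rewrite /integral_at; case: eqVneq => [x0|x0] /=.
  have n0 : fnum x = 0 by apply/eqP; rewrite fnum_eq0 x0.
  case: v => [p|] /=; last by rewrite fden_neq0 n0 size_poly0.
  have := fnum_fden_coprime x; rewrite n0 coprime0p => h.
  have [sp _] := place_irr p; rewrite (eqp_dvdr _ h) dvdp1.
  by rewrite neq_ltn sp orbT.
case: v => [p|] /=; last by rewrite fden_neq0 subr_ge0 lez_nat.
have [sp _] := place_irr p.
case: (boolP (sval p %| fden x)) => pd /=; last by rewrite (pmult_eq0 pd) subr0.
have pn : ~~ (sval p %| fnum x).
  apply/negP => pn; have := coprimep_dvdl pd (fnum_fden_coprime x).
  rewrite coprimep_sym => /(coprimep_dvdl pn).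
  by rewrite coprimepp => /eqP h; rewrite h in sp.
rewrite (pmult_eq0 pn) sub0r oppr_ge0 lez_nat leqn0; apply/negbTE.
by rewrite -lt0n pmult_gt0 ?fden_neq0.
Qed.

Lemma reduce_atE v (x : K) : reduce_at v x = fraction_red v (fnum x) (fden x).
Proof. by case: v. Qed.

Lemma integral_frac v a b : fraction_at v a b ->
  integral_at v (a%:F / b%:F) /\ reduce_at v (a%:F / b%:F) = fraction_red v a b.
Proof.
move=> ab; have b0 := fraction_at_neq0 ab.
rewrite integral_atE reduce_atE; set x := _ / _.
have cr := fnum_fden_cross a b0; have d0 := fden_neq0 x; rewrite -/x in cr.
case: v ab => [p|] /= ab.
  have pd : ~~ (sval p %| fden x).
    by apply: contra ab => h; apply: dvdp_trans h (fden_dvd _ b0).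
  split=> //; apply/eqP; rewrite eqr_div ?polyred_eq0 // -!rmorphM /= cr.
  by [].
case/andP: ab => _ sab.
have ss : (size (fnum x) <= size (fden x))%N.
  have [->|n0] := eqVneq (fnum x) 0; first by rewrite size_poly0.
  have a0 : a != 0.
    by apply/eqP => a0; move: cr; rewrite a0 mul0r => /eqP; rewrite mulf_eq0 (negPf n0) (negPf b0).
  have := congr1 (fun u : {poly k} => size u) cr; rewrite !size_mul //.
  have := sab; rewrite -size_poly_gt0 in b0; rewrite -size_poly_gt0 in a0.
  by move: (size _) (size a) (size b) (size (fden x)) a0 b0 => *; lia.
rewrite d0 ss; split=> //; apply/eqP; rewrite eqr_div ?lead_coef_eq0 //.
have sb := size_poly_gt0 b; rewrite b0 in sb.
have sd := size_poly_gt0 (fden x); rewrite d0 in sd.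
rewrite /lead_coef -coefM_top ?prednK // -coefM_top ?prednK // cr.
by rewrite addnC.
Qed.

Lemma reduceD v (x y : K) : integral_at v x -> integral_at v y ->
  integral_at v (x + y) /\ reduce_at v (x + y) = reduce_at v x + reduce_at v y.
Proof.
rewrite !integral_atE => hx hy; rewrite (reduce_atE v x) (reduce_atE v y).
move: (fnum x) (fden x) (fnum y) (fden y) hx hy (fnum_fden x) (fnum_fden y).
move=> a b c d ab cd -> ->.
have b0 := fraction_at_neq0 ab; have d0 := fraction_at_neq0 cd.
rewrite addf_div ?tofrac_eq0 // -!rmorphM -rmorphD /= -integral_atE.
have : fraction_at v (a * d + c * b) (b * d).
  case: v ab cd => [p|] /=.
    by rewrite -!polyred_eq0 rmorphM /= mulf_eq0 negb_or => -> ->.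
  rewrite mulf_neq0 // => /andP[_ sa] /andP[_ sc].
  apply: leq_trans (size_polyD _ _) _; rewrite geq_max [size (b * d)]size_mul //.
  by apply/andP; split; apply: leq_trans (size_polyMleq _ _) _;
    move: sa sc; move: (size a) (size b) (size c) (size d) => *; lia.
case/integral_frac => h1 h2; split => //; rewrite h2.
case: v ab cd {h1 h2} => [p|] /=.
  rewrite -!polyred_eq0 => pb pd.
  by rewrite addf_div // rmorphD !rmorphM.
case/andP => _ sa /andP[_ sc].
have sb := size_poly_gt0 b; rewrite b0 in sb.
have sd := size_poly_gt0 d; rewrite d0 in sd.
rewrite addf_div ?lead_coef_eq0 // lead_coefM size_mul //; congr (_ / _).
have -> : (size b + size d).-1.-1 = ((size b).-1 + (size d).-1)%N by lia.
rewrite coefD coefM_top ?prednK // addnC coefM_top ?prednK //.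
Qed.

Lemma reduceM v (x y : K) : integral_at v x -> integral_at v y ->
  integral_at v (x * y) /\ reduce_at v (x * y) = reduce_at v x * reduce_at v y.
Proof.
rewrite !integral_atE => hx hy; rewrite (reduce_atE v x) (reduce_atE v y).
move: (fnum x) (fden x) (fnum y) (fden y) hx hy (fnum_fden x) (fnum_fden y).
move=> a b c d ab cd -> ->.
have b0 := fraction_at_neq0 ab; have d0 := fraction_at_neq0 cd.
rewrite mulf_div -!rmorphM /= -integral_atE.
have : fraction_at v (a * c) (b * d).
  case: v ab cd => [p|] /=.
    by rewrite -!polyred_eq0 rmorphM /= mulf_eq0 negb_or => -> ->.
  rewrite mulf_neq0 // => /andP[_ sa] /andP[_ sc]; rewrite [size (b * d)]size_mul //.
  by apply: leq_trans (size_polyMleq _ _) _;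
    move: sa sc; move: (size a) (size b) (size c) (size d) => *; lia.
case/integral_frac => h1 h2; split => //; rewrite h2.
case: v ab cd {h1 h2} => [p|] /=.
  by move=> pb pd; rewrite mulf_div !rmorphM.
case/andP => _ sa /andP[_ sc].
have sb := size_poly_gt0 b; rewrite b0 in sb.
have sd := size_poly_gt0 d; rewrite d0 in sd.
rewrite mulf_div lead_coefM size_mul //; congr (_ / _).
have -> : (size b + size d).-1.-1 = ((size b).-1 + (size d).-1)%N by lia.
by rewrite coefM_top ?prednK.
Qed.

Lemma integral_const v (c : k) :
  integral_at v (c%:P)%:F /\ (c != 0 -> reduce_at v (c%:P)%:F != 0).
Proof.
rewrite -[X in integral_at v X]divr1 -[X in reduce_at v X]divr1 -tofrac1.
have : fraction_at v c%:P 1.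
  case: v => [p|] /=; last by rewrite oner_eq0 size_poly1 size_polyC leq_b1.
  by rewrite -polyred_eq0 rmorph1 oner_eq0.
case/integral_frac => h1 h2; split => // c0; rewrite h2.
case: v {h1 h2} => [p|] /=.
  rewrite rmorph1 divr1 polyred_eq0; apply/negP => /dvdp_leq.
  rewrite polyC_eq0 c0 size_polyC c0 => /(_ isT).
  by have [sp _] := place_irr p; rewrite leqNgt sp.
by rewrite lead_coef1 divr1 size_poly1 /= coefC.
Qed.

Lemma integral_inv v (x : K) : x != 0 -> integral_at v x || integral_at v x^-1.
Proof.
move=> x0; rewrite /integral_at invr_eq0 (negPf x0) /= ordv_inv // oppr_ge0.
exact: le_total.
Qed.

Lemma integral_unit v (x : K) : integral_at v x -> reduce_at v x != 0 ->
  integral_at v x^-1.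
Proof.
rewrite integral_atE reduce_atE => hx rx.
have n0 : fnum x != 0.
  apply: contra rx => /eqP ->; case: v hx => [p|] /= _; first by rewrite rmorph0 mul0r.
  by rewrite coef0 mul0r.
rewrite {1}[x]fnum_fden invf_div.
suff : fraction_at v (fden x) (fnum x) by case/integral_frac.
case: v hx rx => [p|] /= hx rx.
  by rewrite -polyred_eq0; apply: contra rx => /eqP ->; rewrite mul0r.
rewrite n0; rewrite leqNgt; apply: contra rx => lt.
rewrite nth_default ?mul0r //.
by move: lt; case: (size (fden x)).
Qed.

Lemma integral_ordv v (x : K) : x != 0 -> integral_at v x -> integral_at v x^-1 ->
  ordv v x = 0.
Proof.
move=> x0; rewrite /integral_at invr_eq0 (negPf x0) /= ordv_inv // oppr_ge0 => h1 h2.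
by apply: le_anti; rewrite h1 h2.
Qed.

Lemma ordv_le0_inv v (x : K) : x != 0 -> ordv v x <= 0 -> integral_at v x^-1.
Proof. by move=> x0; rewrite /integral_at invr_eq0 (negPf x0) /= ordv_inv // oppr_ge0. Qed.

End Reduction.

(** * Weierstrass models *)

Lemma disc_change_vars (K : fieldType) (u r s t : K) (W : weierstrass K) :
  u != 0 -> disc (change_vars u r s t W) = disc W / u ^+ 12.
Proof. by case: W => a1 a2 a3 a4 a6 u0; rewrite /disc /change_vars; field. Qed.

Lemma npoints_change_vars (F : finFieldType) (u r s t : F) (W : weierstrass F) :
  u != 0 -> npoints (change_vars u r s t W) = npoints W.
Proof.
case: W => a1 a2 a3 a4 a6 u0; rewrite /npoints; congr S.
pose f (P : F * F) := (u ^+ 2 * P.1 + r, u ^+ 3 * P.2 + s * u ^+ 2 * P.1 + t).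
have finj : injective f.
  move=> [x y] [x' y'] [] /addIr /(mulfI (expf_neq0 2 u0)) <-.
  by move=> /addIr /addIr /(mulfI (expf_neq0 3 u0)) <-.
rewrite -(card_imset _ finj); apply: eq_card => -[x y]; rewrite inE /=.
apply/imsetP/idP => [[[x' y'] ]|h].
  rewrite inE /= => /eqP h [-> ->]; apply/eqP.
  have e6 := congr1 (fun z => z * u ^+ 6) h; rewrite /= in e6.
  apply/eqP; rewrite -subr_eq0; apply/eqP.
  move/eqP: e6; rewrite -subr_eq0 => /eqP e6; rewrite -[RHS]e6; field.
  by [].
exists ((x - r) / u ^+ 2, (y - s * (x - r) - t) / u ^+ 3); last first.
  by rewrite /f /=; congr (_, _); field.
rewrite inE /=; move/eqP: h => h; apply/eqP.
move/eqP: h; rewrite -subr_eq0 => /eqP h; apply/eqP; rewrite -subr_eq0; apply/eqP.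
by rewrite -[RHS](mul0r (u ^- 6)) -h; field.
Qed.

(** In characteristic 3 the element 2 is its own inverse, so s and t can be solved for, and r
    survives only inside r^3 + a r + x. Integrality of r, s and t thereby reduces to that of u. *)
Lemma short_model_coefs (K : fieldType) (u r s t a x : K) : u != 0 -> 3%:R = 0 :> K ->
  let W := change_vars u r s t (Weierstrass 0 0 0 a x) in
  [/\ s = 2%:R * wa1 W * u, wa2 W = - (s / u) ^+ 2, t = 2%:R * wa3 W * u ^+ 3,
      wa4 W = a / u ^+ 4 + (s / u) * (t / u ^+ 3)
    & r ^+ 3 + a * r + x = wa6 W * u ^+ 6 + t ^+ 2].
Proof.
move=> u0 c3 /=; have z3 (y : K) : 3%:R * y = 0 by rewrite c3 mul0r.
split; last by field.
- by apply/eqP; rewrite -subr_eq0; apply/eqP; rewrite -[RHS](z3 (- s)); field.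
- by apply/eqP; rewrite -subr_eq0; apply/eqP; rewrite -[RHS](z3 (r / u ^+ 2)); field.
- by apply/eqP; rewrite -subr_eq0; apply/eqP; rewrite -[RHS](z3 (- t)); field.
- by apply/eqP; rewrite -subr_eq0; apply/eqP; rewrite -[RHS](z3 ((r ^+ 2 - s * t) / u ^+ 4)); field.
Qed.

(** Independence from x is the point: the discriminant of the curve is a nonzero constant, hence a
    unit at every place. *)
Lemma disc_short_char3 (R : comNzRingType) (a x : R) : 3%:R = 0 :> R ->
  disc (Weierstrass 0 0 0 a x) = - a ^+ 3.
Proof.
move=> c3; rewrite /disc; apply/eqP; rewrite -subr_eq0; apply/eqP.
transitivity (3%:R * (- 21%:R * a ^+ 3 - 9%:R * (4%:R * x) ^+ 2)); first by ring.
by rewrite c3 mul0r.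
Qed.

Section Reduces.
Variables (k : finFieldType) (v : place k).
Local Notation K := {fraction {poly k}}.
Local Notation "x %:F" := (FracField.tofrac x).

(** Bundling integrality with the value lets [reduces_auto] follow the syntax of a polynomial
    expression and prove both at once. *)
Definition reduces (x : K) (y : residue_field v) : Prop :=
  integral_at v x /\ reduce_at v x = y.

Lemma reducesD x y x' y' : reduces x y -> reduces x' y' -> reduces (x + x') (y + y').
Proof. by move=> [i <-] [i' <-]; exact: reduceD. Qed.

Lemma reducesM x y x' y' : reduces x y -> reduces x' y' -> reduces (x * x') (y * y').
Proof. by move=> [i <-] [i' <-]; exact: reduceM. Qed.

Lemma reduces_int x : integral_at v x -> reduces x (reduce_at v x).
Proof. by []. Qed.

Lemma reduces_uniq x y y' : reduces x y -> reduces x y' -> y = y'.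
Proof. by move=> [_ <-] [_ <-]. Qed.

Lemma reduces0 : reduces 0 0.
Proof.
have i0 : integral_at v 0 by rewrite /integral_at eqxx.
have [_ h] := reduceD i0 i0; split=> //; apply: (@addrI _ (reduce_at v 0)).
by rewrite -h !addr0.
Qed.

Lemma reduces1 : reduces 1 1.
Proof.
have [i1 n1] := integral_const v (1 : k); rewrite -[_%:F]/(1 : K) in i1 n1.
have [_ h] := reduceM i1 i1; split => //; rewrite mulr1 in h.
by apply: (mulIf (n1 (oner_neq0 _))); rewrite mul1r -h.
Qed.

Lemma reducesN x y : reduces x y -> reduces (- x) (- y).
Proof.
have [im _] := integral_const v (-1 : k).
have imE : (((-1 : k)%:P)%:F : K) = -1 by rewrite polyCN !rmorphN /= !rmorph1.
rewrite imE in im.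
have rm : reduce_at v (-1) = -1.
  apply: (@addIr _ 1); rewrite addNr.
  rewrite -(reduces_uniq (reducesD (reduces_int im) reduces1) (y' := 0)) //.
  by rewrite addNr; exact: reduces0.
by move=> h; rewrite -mulN1r -[- y]mulN1r -rm; apply: reducesM h.
Qed.

Lemma reducesX x y n : reduces x y -> reduces (x ^+ n) (y ^+ n).
Proof.
move=> h; elim: n => [|n IH]; first by rewrite !expr0; exact: reduces1.
by rewrite !exprS; apply: reducesM.
Qed.

Lemma reduces_nat n : reduces n%:R n%:R.
Proof.
elim: n => [|n IH]; first exact: reduces0.
by rewrite -!natr1; apply: reducesD IH reduces1.
Qed.

Lemma reducesV x y : y != 0 -> reduces x y -> reduces x^-1 y^-1.
Proof.
move=> y0 h; have [i e] := h; have i' : integral_at v x^-1.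
  by apply: integral_unit => //; rewrite e.
split => //; have x0 : x != 0.
  by apply: contra y0 => /eqP x0; rewrite -(reduces_uniq reduces0 (y' := y)) // -x0.
apply: (mulIf y0); rewrite mulVf //.
by apply: reduces_uniq (reducesM (reduces_int i') h) _; rewrite mulVf //; exact: reduces1.
Qed.

End Reduces.

Ltac reduces_auto := repeat (lazymatch goal with
  | |- reduces (_ + _) _ => refine (reducesD _ _)
  | |- reduces (- _) _ => refine (reducesN _)
  | |- reduces (_ * _) _ => refine (reducesM _ _)
  | |- reduces (_ ^+ _) _ => refine (reducesX _ _)
  | |- reduces _%:R _ => refine (reduces_nat _ _)
  | |- reduces 0 _ => refine (reduces0 _)
  | |- reduces 1 _ => refine (reduces1 _)
  | |- _ => eassumption end).

(** * Discriminant and existence of minimal models *)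

Section LocalFactor.
Variables (k : finFieldType) (r0 n : nat) (c : k).
Hypotheses (cardk : #|k| = (3 ^ r0)%N) (c_neq0 : c != 0).
Local Notation K := {fraction {poly k}}.
Local Notation "x %:F" := (FracField.tofrac x).
Local Notation E := (curve_E n c).

Lemma three_eq0_K : 3%:R = 0 :> K.
Proof. by rewrite -(rmorph_nat (@FracField.tofrac {poly k})) -polyC_natr (three_eq0 cardk). Qed.

Lemma disc_curve : disc E = - (((c ^+ 3)%:P)%:F).
Proof. by rewrite /curve_E disc_short_char3 ?three_eq0_K // polyC_exp tofracXn. Qed.

Lemma disc_curve_neq0 : disc E != 0.
Proof. by rewrite disc_curve oppr_eq0 tofrac_eq0 polyC_eq0 expf_neq0. Qed.

Section AtPlace.
Variable v : place k.

Lemma integral_poly_finite (p : finite_place k) (g : {poly k}) :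
  reduces (v := Some p) g%:F (polyred p g).
Proof.
rewrite -[g%:F]divr1 -tofrac1.
have : fraction_at (Some p) g 1 by rewrite /= -polyred_eq0 rmorph1 oner_eq0.
by case/integral_frac => h1 h2; split => //; rewrite h2 /= rmorph1 divr1.
Qed.

Lemma disc_reduces (W : weierstrass K) :
  [/\ integral_at v (wa1 W), integral_at v (wa2 W), integral_at v (wa3 W),
      integral_at v (wa4 W) & integral_at v (wa6 W)] ->
  reduces (disc W) (disc (map_weierstrass (@reduce_at _ v) W)).
Proof.
case: W => a1 a2 a3 a4 a6 /= [] /reduces_int h1 /reduces_int h2 /reduces_int h3
  /reduces_int h4 /reduces_int h6.
rewrite /disc /map_weierstrass /=; reduces_auto.
Qed.

Lemma disc_unit : reduces (v := v) (disc E) (reduce_at v (disc E)) /\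
  reduce_at v (disc E) != 0.
Proof.
have [i nz] := integral_const v (c ^+ 3).
have h := reducesN (reduces_int i).
rewrite disc_curve; have [ih ->] := h; split => //.
by rewrite oppr_eq0 nz // expf_neq0.
Qed.

Lemma model_disc W : model_of E W -> exists2 u : K, u != 0 & disc W = disc E / u ^+ 12.
Proof. by case=> u [r [s [t [u0 ->]]]]; exists u; rewrite ?disc_change_vars. Qed.

Lemma model_disc_neq0 W : model_of E W -> disc W != 0.
Proof.
case/model_disc => u u0 ->; apply: mulf_neq0; first exact: disc_curve_neq0.
exact: invr_neq0 (expf_neq0 12 u0).
Qed.

Lemma model_disc_ge0 W : integral_model E v W -> 0 <= ordv v (disc W).
Proof.
case=> m /disc_reduces[]; rewrite /integral_at (negPf (model_disc_neq0 m)) //.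
Qed.

(** Discriminants of integral models have nonnegative valuation, so descent from any integral model
    ends at a minimal one, and [epsilon] then returns some minimal model. *)
Lemma exists_minimal W : integral_model E v W ->
  minimal_integral_model E v (minimal_model E v).
Proof.
move=> hW; apply: epsilon_spec.
move: {2}`|ordv v (disc W)|%N (leqnn `|ordv v (disc W)|%N) => m.
elim: m W hW => [|m IH] W hW hm.
  exists W; split=> // W' hW'; have := model_disc_ge0 hW'; have := model_disc_ge0 hW.
  by move: hm; lia.
case: (classic (forall W', integral_model E v W' -> ordv v (disc W) <= ordv v (disc W'))).
  by exists W.
move=> /Classical_Pred_Type.not_all_ex_not[W'] nh.
have [hW' lt] : integral_model E v W' /\ ordv v (disc W') < ordv v (disc W).
  case: (classic (integral_model E v W')) => h1; last by case: nh.
  by split=> //; rewrite ltNge; apply/negP => h2; case: nh.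
apply: (IH W') => //; have := model_disc_ge0 hW'; have := model_disc_ge0 hW.
by move: hm lt; lia.
Qed.

End AtPlace.

End LocalFactor.

Lemma change_vars_id (K : fieldType) (W : weierstrass K) : change_vars 1 0 0 0 W = W.
Proof.
by case: W => a1 a2 a3 a4 a6; rewrite /change_vars !expr1n !divr1; congr Weierstrass; ring.
Qed.

Lemma expSr_mulV (F : fieldType) (x : F) n : x != 0 -> x = x ^+ n.+1 * x^-1 ^+ n.
Proof. by move=> x0; rewrite exprS exprVn mulfK // expf_neq0. Qed.

Lemma mul_eq_div (F : fieldType) (w u e : F) : w != 0 -> w * u = e ->
  (u = e * w^-1) * (u^-1 = w * e^-1).
Proof.
by move=> w0 <-; split; [rewrite mulrAC divff ?mul1r | rewrite invfM mulrA divff ?mul1r].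
Qed.

Section IntegralClosure.
Variables (k : finFieldType) (v : place k).
Local Notation K := {fraction {poly k}}.

Lemma integral_of_reduces (x : K) (y : residue_field v) : reduces x y -> integral_at v x.
Proof. by case. Qed.

Lemma integral_exp_closed (x : K) n : (0 < n)%N -> integral_at v (x ^+ n) -> integral_at v x.
Proof.
case: n => // n _ h; have [->|x0] := eqVneq x 0; first by rewrite /integral_at eqxx.
have /orP[//|i] := integral_inv v x0.
rewrite (expSr_mulV n x0).
exact: integral_of_reduces (reducesM (reduces_int h) (reducesX n (reduces_int i))).
Qed.

Lemma reduce_inv_eq0 (x : K) : ~~ integral_at v x -> reduces (v := v) x^-1 0.
Proof.
move=> h; have x0 : x != 0 by apply: contra h => /eqP->; rewrite /integral_at eqxx.
have := integral_inv v x0; rewrite (negPf h) /= => i; split=> //.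
apply/eqP; apply: contraNT h => nz.
by have := integral_unit i nz; rewrite invrK.
Qed.

(** If z were not integral, y = 1/z would reduce to 0, and (z^3 + a z) y^3 = 1 + a y^2 would reduce
    both to 0 and to 1. *)
Lemma integral_cubic_root (a z : K) : integral_at v a ->
  integral_at v (z ^+ 3 + a * z) -> integral_at v z.
Proof.
move=> ia iz; apply: contraT => nz.
have z0 : z != 0 by apply: contra nz => /eqP->; rewrite /integral_at eqxx.
have hz := reduce_inv_eq0 nz; set y := z^-1 in hz.
have yz : y * z = 1 by rewrite mulVf.
have e1 : reduces (v := v) (1 + a * y ^+ 2) (1 + reduce_at v a * 0 ^+ 2).
  exact: reducesD (reduces1 v) (reducesM (reduces_int ia) (reducesX 2 hz)).
have e2 := reducesM (reduces_int iz) (reducesX 3 hz).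
have E : (z ^+ 3 + a * z) * y ^+ 3 = 1 + a * y ^+ 2.
  have -> : (z ^+ 3 + a * z) * y ^+ 3 = (y * z) ^+ 3 + a * y ^+ 2 * (y * z) by ring.
  by rewrite yz expr1n mulr1.
rewrite E in e2; have := reduces_uniq e1 e2.
by rewrite !expr0n /= !mulr0 addr0 => /eqP; rewrite oner_eq0.
Qed.

Lemma reduce_unit_neq0 (x : K) : x != 0 -> integral_at v x -> integral_at v x^-1 ->
  reduce_at v x != 0.
Proof.
move=> x0 i i'; apply/eqP => h.
have := reducesM (reduces_int i) (reduces_int i'); rewrite h mul0r divff // => h0.
by have /eqP := reduces_uniq (reduces1 v) h0; rewrite oner_eq0.
Qed.

End IntegralClosure.

(** * Reduction at the finite places *)

Section FinitePlace.
Variables (k : finFieldType) (r0 n : nat) (c : k) (p : finite_place k).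
Hypotheses (cardk : #|k| = (3 ^ r0)%N) (c_neq0 : c != 0).
Local Notation K := {fraction {poly k}}.
Local Notation "x %:F" := (FracField.tofrac x).
Local Notation E := (curve_E n c).
Local Notation v := (Some p).

Definition reduced_curve : weierstrass (residue_field v) :=
  Weierstrass 0 0 0 (polyred p c%:P) (polyred p 'X^((3 ^ n).+1)).

Lemma curve_integral : integral_model E v E.
Proof.
split; first by exists 1, 0, 0, 0; rewrite oner_neq0 change_vars_id.
have i0 : integral_at v (0 : K) by rewrite /integral_at eqxx.
split=> //=; first by have [] := integral_poly_finite p c%:P.
by have [] := integral_poly_finite p 'X^((3 ^ n).+1).
Qed.

(** The given equation is integral with unit discriminant, so a minimal discriminant is a unit too.
    Then u^12 is a unit, hence u is; s, t and r follow by [short_model_coefs], and the change of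
    variables itself reduces modulo v. *)
Lemma reduction_finite : exists u r s t : residue_field v,
  u != 0 /\ reduction E v = change_vars u r s t reduced_curve.
Proof.
have [[[u [r [s [t [u0 WE]]]]] ints] min] := exists_minimal cardk c_neq0 curve_integral.
have {min} := min _ curve_integral.
have dW := disc_reduces ints.
rewrite /reduction; move: (minimal_model E v) WE ints dW => W WE ints dW hmin.
have [dE dE0] := disc_unit n cardk c_neq0 v.
have E0 := disc_curve_neq0 n cardk c_neq0.
have iE' : integral_at v (disc E)^-1 by apply: integral_unit (proj1 dE) dE0.
rewrite (integral_ordv E0 (proj1 dE) iE') in hmin.
have dWE : disc W = disc E / u ^+ 12 by rewrite WE; exact: disc_change_vars.
have W0 : disc W != 0.
  by rewrite dWE; exact: mulf_neq0 E0 (invr_neq0 (expf_neq0 12 u0)).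
have iW' := ordv_le0_inv W0 hmin.
have u12 : disc W * u ^+ 12 = disc E.
  by rewrite dWE; exact: divfK (expf_neq0 12 u0) _.
have [u12E u12V] := mul_eq_div W0 u12.
have iu : integral_at v u.
  apply: (@integral_exp_closed _ _ u 12 isT); rewrite u12E.
  exact: integral_of_reduces (reducesM dE (reduces_int iW')).
have iu' : integral_at v u^-1.
  apply: (@integral_exp_closed _ _ u^-1 12 isT); rewrite exprVn u12V.
  exact: integral_of_reduces (reducesM dW (reduces_int iE')).
have nu := reduce_unit_neq0 u0 iu iu'.
have hu := reduces_int iu.
have hc := integral_poly_finite p c%:P.
have hx := integral_poly_finite p 'X^((3 ^ n).+1).
have [sE _ tE _ rE] := @short_model_coefs K u r s t (c%:P)%:F ('X^((3 ^ n).+1))%:F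
  u0 (three_eq0_K cardk).
rewrite -[change_vars _ _ _ _ _]WE in sE tE rE.
case: ints => /reduces_int h1 /reduces_int h2 /reduces_int h3 /reduces_int h4 /reduces_int h6.
have hs : reduces (v := v) s (reduce_at v s).
  apply: reduces_int; rewrite sE; eapply integral_of_reduces; reduces_auto.
have ht : reduces (v := v) t (reduce_at v t).
  apply: reduces_int; rewrite tE; eapply integral_of_reduces; reduces_auto.
have hr : reduces (v := v) r (reduce_at v r).
  apply: reduces_int; apply: (integral_cubic_root (integral_of_reduces hc)).
  have -> : r ^+ 3 + (c%:P)%:F * r = wa6 W * u ^+ 6 + t ^+ 2 - ('X^((3 ^ n).+1))%:F.
    by rewrite -rE; exact: esym (addrK _ _).
  eapply integral_of_reduces; reduces_auto.
exists (reduce_at v u), (reduce_at v r), (reduce_at v s), (reduce_at v t); split=> //.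
have hv1 := reducesV nu hu.
have hv i := reducesV (expf_neq0 i nu) (reducesX i hu).
have hv2 := hv 2%N; have hv3 := hv 3%N; have hv4 := hv 4%N; have hv6 := hv 6%N.
rewrite WE /map_weierstrass /change_vars /curve_E /reduced_curve.
move: hc hx; set a := (c%:P)%:F; set x := ('X^_)%:F => hc hx.
have red y z : reduces (v := v) y z -> reduce_at v y = z by case.
by congr Weierstrass; apply: red; cbn [wa1 wa2 wa3 wa4 wa6]; reduces_auto.
Qed.

End FinitePlace.

(** In characteristic 3 the equation reads (y + s x + t)^2 = x^3 + constant. Cubing is bijective, so
    each value of y + s x + t belongs to exactly one affine point. *)
Lemma npoints_cuspidal (F : finFieldType) r (s t g : F) : #|F| = (3 ^ r)%N ->
  npoints (Weierstrass (2%:R * s) (- s ^+ 2) (2%:R * t) (s * t) g) = #|F|.+1.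
Proof.
move=> cF; rewrite /npoints; congr S.
pose f (P : F * F) := P.2 + s * P.1 + t.
have key (x y : F) : ((x, y) \in affine_points
    (Weierstrass (2%:R * s) (- s ^+ 2) (2%:R * t) (s * t) g)) =
    (f (x, y) ^+ 2 == x ^+ 3 + (g + t ^+ 2)).
  rewrite inE /f /= -subr_eq0 -[RHS]subr_eq0; congr (_ == 0).
  apply/eqP; rewrite -subr_eq0; apply/eqP.
  rewrite -[RHS](mul0r (- (s * t * x))) -(three_eq0 cF); ring.
have finj : {in affine_points (Weierstrass (2%:R * s) (- s ^+ 2) (2%:R * t) (s * t) g) &,
    injective f}.
  move=> [x y] [x' y']; rewrite !key => /eqP h /eqP h' e.
  have xx : x = x'.
    by apply: (exp3_inj cF (i := 1)); apply: (@addIr _ (g + t ^+ 2)); rewrite -h -h' e.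
  by move: e; rewrite /f xx /= => /addIr /addIr ->.
rewrite -(card_in_imset finj) -cardsT; apply: eq_card => z; rewrite inE.
apply/imsetP.
have : z ^+ 2 - (g + t ^+ 2) \in codom (fun x : F => x ^+ (3 ^ 1)).
  exact: (injF_onto (exp3_inj cF (i := 1))).
case/codomP => x xE; exists (x, z - s * x - t); last by rewrite /f /=; ring.
rewrite key /f /= -[x ^+ 3]xE; apply/eqP; ring.
Qed.

(** * Reduction at infinity *)

Section InfinitePlace.
Variables (k : finFieldType) (r0 n : nat) (c : k).
Hypotheses (cardk : #|k| = (3 ^ r0)%N) (c_neq0 : c != 0) (n_gt0 : (0 < n)%N).
Local Notation K := {fraction {poly k}}.
Local Notation "x %:F" := (FracField.tofrac x).
Local Notation E := (curve_E n c).
Local Notation v := (None : place k).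
Let q := (3 ^ n)%N.

Lemma integral_infty_size (a b : {poly k}) : b != 0 ->
  integral_at v (a%:F / b%:F) -> (size a <= size b)%N.
Proof.
move=> b0; rewrite integral_atE; have := fnum_fden_cross a b0.
have := fden_neq0 (a%:F / b%:F).
move: (fnum _) (fden _) => f d d0 cr /andP[_ sfd].
have [->|a0] := eqVneq a 0; first by rewrite size_poly0.
have f0 : f != 0.
  by apply: contraNneq a0 => f0; move/eqP: cr; rewrite f0 mul0r eq_sym mulf_eq0 (negPf d0) orbF.
have := congr1 (fun u : {poly k} => size u) cr; rewrite /= !size_mul //.
rewrite -size_poly_gt0 in a0; rewrite -size_poly_gt0 in b0.
rewrite -size_poly_gt0 in d0; rewrite -size_poly_gt0 in f0.
move: sfd a0 b0 d0 f0; move: (size a) (size b) (size d) (size f) => *; lia.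
Qed.

(* The pole order q + 1 at infinity is prime to 3, so it cannot be cancelled by
   an element of the form z^3 + c z. *)
Lemma not_integral_infty (z : K) :
  ~~ integral_at v (z ^+ 3 + (c%:P)%:F * z + ('X^(q.+1))%:F).
Proof.
have q3 : (q = 3 * 3 ^ n.-1)%N by rewrite -expnS prednK.
have := fnum_fden z; have := fden_neq0 z.
move: (fnum z) (fden z) => a d d0 zE.
have D0 : d%:F != 0 by rewrite tofrac_eq0.
have comb (F : fieldType) (A D C X : F) : D != 0 ->
    (A / D) ^+ 3 + C * (A / D) + X = (A ^+ 3 + C * A * D ^+ 2 + X * D ^+ 3) / D ^+ 3.
  by move=> DD; field.
rewrite zE (comb _ _ _ _ _ D0) -!tofracXn -!tofracM -!tofracD.
apply/negP => /(integral_infty_size (expf_neq0 3 d0)).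
have szX (g : {poly k}) m : g != 0 -> size (g ^+ m) = (m * (size g).-1).+1.
  by move=> g0; rewrite mulnC -size_exp prednK // size_poly_gt0 expf_neq0.
have sd3 : size (d ^+ 3) = (3 * (size d).-1).+1 by rewrite szX.
have s3 : size ('X^(q.+1) * d ^+ 3) = (q.+1 + 3 * (size d).-1).+1.
  by rewrite size_monicM ?monicXn ?expf_neq0 // size_polyXn sd3 /=; lia.
rewrite sd3 leqNgt => /negP; apply.
have sd : (0 < size d)%N by rewrite size_poly_gt0.
have [a0|a0] := eqVneq a 0.
  by rewrite a0 expr0n mulr0 mul0r !add0r s3; lia.
have sa : (0 < size a)%N by rewrite size_poly_gt0.
have s1 : size (a ^+ 3) = (3 * (size a).-1).+1 by rewrite szX.
have s2 : size (c%:P * a * d ^+ 2) = ((size a).-1 + 2 * (size d).-1).+1.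
  rewrite -mulrA size_Cmul // size_mul ?expf_neq0 // szX //.
  by move: (size a) (size d) sa sd => *; lia.
have s12 : (size a <= size d)%N -> (size (a ^+ 3 + c%:P * a * d ^+ 2)%R <= (3 * (size d).-1).+1)%N.
  move=> le; apply: leq_trans (size_polyD _ _) _; rewrite geq_max s1 s2.
  by move: (size a) (size d) le => *; lia.
have s12' : (size d < size a)%N -> size (a ^+ 3 + c%:P * a * d ^+ 2) = (3 * (size a).-1).+1.
  by move=> lt; rewrite size_polyDl s1 // s2; move: (size a) (size d) lt sd => *; lia.
have [le|lt] := leqP (size a) (size d).
  rewrite addrC size_polyDl s3; first lia.
  by apply: leq_ltn_trans (s12 le) _; lia.
have h := s12' lt.
(* By [q3], q + 1 is 1 modulo 3, so the two degrees never coincide and the larger one is the degree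
   of the numerator; both exceed that of d^3. *)
have [le2|lt2] := leqP (3 * (size a).-1) (q.+1 + 3 * (size d).-1).
  by rewrite addrC size_polyDl s3 ?h; lia.
by rewrite size_polyDl h ?s3; lia.
Qed.

Lemma integral_model_infty : exists W, integral_model E v W.
Proof.
(* A crude scaling: the coefficients become c / t^(4(q+1)) and t^(-5(q+1)). It only provides a
   starting point for the descent. *)
pose u : K := ('X^(q.+1))%:F.
have u0 : u != 0 by rewrite tofrac_eq0 -size_poly_eq0 size_polyXn.
exists (change_vars u 0 0 0 E); split; first by exists u, 0, 0, 0.
have i0 : integral_at v (0 : K) by rewrite /integral_at eqxx.
have fr (a b : {poly k}) : b != 0 -> (size a <= size b)%N -> integral_at v (a%:F / b%:F).
  by move=> b0 s; have [] := @integral_frac k v a b; rewrite /= ?b0.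
have short (F : fieldType) (w a x : F) : change_vars w 0 0 0 (Weierstrass 0 0 0 a x) =
    Weierstrass 0 0 0 (a / w ^+ 4) (x / w ^+ 6).
  rewrite /change_vars; congr Weierstrass; rewrite ?expr0n /=;
    by rewrite !(mulr0, mul0r, addr0, add0r, subr0, oppr0).
rewrite [change_vars _ _ _ _ _]short /= /u -!tofracXn -!exprM.
split=> //; apply: fr; rewrite -?size_poly_gt0 ?size_polyXn //.
  by rewrite size_polyC; case: (c != 0).
by rewrite ltnS leq_pmulr.
Qed.

(** An integral u would make r^3 + c r + t^(q+1) integral, against [not_integral_infty]. Hence 1/u
    reduces to 0, which kills the discriminant and the term c / u^4 of a4; the remaining cubic has
    |k| affine points, so the trace is 0. *)
Lemma local_factor_infty : local_factor E v = 1.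
Proof.
have [W0 hW0] := integral_model_infty.
have [[[u [r [s [t [u0 WE]]]]] ints] _] := exists_minimal cardk c_neq0 hW0.
have dW := disc_reduces ints.
rewrite /local_factor /good_reduction /trace_at /reduction.
move: (minimal_model E v) WE ints dW => W WE ints dW.
have dWE : disc W = disc E / u ^+ 12 by rewrite WE; exact: disc_change_vars.
have [sE a2E tE a4E rE] := @short_model_coefs K u r s t (c%:P)%:F ('X^((3 ^ n).+1))%:F
  u0 (three_eq0_K cardk).
rewrite -[change_vars _ _ _ _ _]WE in sE a2E tE a4E rE.
case: (ints) => /reduces_int h1 /reduces_int h2 /reduces_int h3 /reduces_int h4 /reduces_int h6.
have nu : ~~ integral_at v u.
  apply/negP => /reduces_int hu.
  have := not_integral_infty r; rewrite /q rE => /negP; apply.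
  have ht : reduces (v := v) t (reduce_at v t).
    apply: reduces_int; rewrite tE; eapply integral_of_reduces; reduces_auto.
  eapply integral_of_reduces; reduces_auto.
have hu := reduce_inv_eq0 nu.
have [dE _] := disc_unit n cardk c_neq0 v.
have d0 : disc (map_weierstrass (@reduce_at _ v) W) = 0.
  apply: reduces_uniq dW _; rewrite dWE -exprVn.
  have := reducesM dE (reducesX 12 hu); rewrite expr0n mulr0; exact.
rewrite d0 eqxx /=.
have ssu : s / u = 2%:R * wa1 W by rewrite {1}sE; exact: mulfK.
have ttu : t / u ^+ 3 = 2%:R * wa3 W by rewrite {1}tE; exact: mulfK (expf_neq0 3 u0) _.
have [hc _] := integral_const v c.
set a1 := reduce_at v (wa1 W); set a3 := reduce_at v (wa3 W).
have WR : map_weierstrass (@reduce_at _ v) W =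
    Weierstrass (2%:R * (2%:R * a1)) (- (2%:R * a1) ^+ 2) (2%:R * (2%:R * a3))
      ((2%:R * a1) * (2%:R * a3)) (reduce_at v (wa6 W)).
  have f4 (x : k) : x = 2%:R * (2%:R * x).
    apply/eqP; rewrite -subr_eq0; apply/eqP.
    by rewrite -[RHS](mul0r (- x)) -(three_eq0 cardk); ring.
  rewrite /map_weierstrass; congr Weierstrass; rewrite -?f4 //.
    rewrite a2E ssu.
    by have [_ ->] := reducesN (reducesX 2 (reducesM (reduces_nat v 2) h1)).
  rewrite a4E ssu ttu.
  have := reducesD (reducesM (reduces_int hc) (reducesX 4 hu))
    (reducesM (reducesM (reduces_nat v 2) h1) (reducesM (reduces_nat v 2) h3)).
  by rewrite exprVn expr0n mulr0 add0r => -[_ ->].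
rewrite WR (npoints_cuspidal _ _ _ cardk).
by rewrite -addn1 PoszD subrr polyC0 mul0r subr0.
Qed.

End InfinitePlace.

(** * Local factors of the curve *)

Section FiniteLocalFactor.
Variables (k : finFieldType) (n : nat) (c lam : k) (p : finite_place k).
Let q := (3 ^ n)%N.
Hypotheses (n_gt0 : (0 < n)%N) (cardk : #|k| = (q ^ 2)%N) (c_neq0 : c != 0).
Hypotheses (lam_c : lam ^+ 2 * c ^+ 3 = -1) (lam_frob : lam ^+ q = - lam).
Let d := place_deg (Some p).
Local Notation F := (residue_field (Some p)).

Let cardk3 : #|k| = (3 ^ (n * 2))%N. Proof. by rewrite cardk /q expnM. Qed.

Let cardF : #|F| = ((3 ^ (n * d)) ^ 2)%N.
Proof. by rewrite card_residue_field_Some cardk /q -!expnM; congr expn; lia. Qed.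

Let cardF3 : #|F| = (3 ^ (n * d * 2))%N.
Proof. by rewrite cardF -expnM. Qed.

Let d_gt0 : (0 < d)%N := place_deg_gt0 p.

Lemma polyred_const_neq0 (a : k) : a != 0 -> polyred p a%:P != 0.
Proof.
move=> a0; rewrite polyred_eq0; apply/negP => /dvdp_leq.
rewrite polyC_eq0 a0 size_polyC a0 => /(_ isT).
by have [sp _] := place_irr p; rewrite leqNgt sp.
Qed.

Lemma lam_frob_iter i : lam ^+ (q ^ i) = (-1) ^+ i * lam.
Proof.
elim: i => [|i IH]; first by rewrite expn0 expr1 expr0 mul1r.
rewrite expnSr exprM IH exprMn lam_frob exprS -exprM mulnC exprM.
by rewrite {1}/q (expN3 cardk3) expr1n; ring.
Qed.

(** The residue field has order P^2 with P = q^d. For odd d, l is negated by the P-th power and the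
    sum is P; for even d it is fixed and the sum is -P. Both equal -(-q)^d. *)
Lemma gauss_place (l : k) : l != 0 -> l ^+ (3 ^ (n * d)) = (-1) ^+ d * l ->
  gauss (polyred p l%:P) = - (- q%:R) ^+ d.
Proof.
move=> l0 lP; have s0 : (0 < n * d)%N by rewrite muln_gt0 n_gt0.
have P0 := polyred_const_neq0 l0.
have lP' : polyred p l%:P ^+ (3 ^ (n * d)) = (-1) ^+ d * polyred p l%:P.
  by rewrite -rmorphXn /= -polyC_exp lP polyCM rmorphM polyC_exp polyCN rmorphXn /= rmorphN rmorph1.
have PE : (3 ^ (n * d))%:R = q%:R ^+ d :> algC by rewrite expnM natrX.
rewrite exprNn; case: (boolP (odd d)) => od.
  rewrite (gauss_antifixed s0 cardF P0) ?PE.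
    by rewrite -signr_odd od expr1 mulN1r opprK.
  by rewrite lP' -signr_odd od expr1 mulN1r.
rewrite (gauss_fixed s0 cardF P0) ?PE.
- by rewrite -signr_odd (negPf od) expr0 mul1r.
- by rewrite lP' -signr_odd (negPf od) expr0 mul1r.
have -> : (n * d = 2 * (n * d./2))%N.
  by rewrite -{1}(odd_double_half d) (negPf od) add0n -mul2n mulnCA.
by rewrite expnM predn_exp dvdn_mulr.
Qed.

Lemma trace_place : (trace_at (curve_E n c) (Some p))%:~R =
  (- q%:R) ^+ d * (place_char (hpoly n lam) p + place_char (hpoly n (- lam)) p) :> algC.
Proof.
have l0 : lam != 0.
  apply/eqP => l0; move/eqP: lam_c; rewrite l0 expr0n mul0r eq_sym oppr_eq0.
  by rewrite oner_eq0.
have lP : lam ^+ (3 ^ (n * d)) = (-1) ^+ d * lam by rewrite expnM lam_frob_iter.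
have [u [r [s [t [u0 redE]]]]] := reduction_finite n p cardk3 c_neq0.
rewrite /trace_at redE npoints_change_vars // /npoints.
have -> : affine_points (reduced_curve n c p) =
   [set P : F * F | P.2 ^+ 2 == P.1 ^+ 3 + polyred p c%:P * P.1 + polyred p 'X^((3 ^ n).+1)].
  by apply/setP => -[x y]; rewrite !inE /= !(mul0r, addr0).
rewrite rmorphB rmorphD /= -!pmulrn -[(#|_|.+1)%:R]natr1.
rewrite (@card_supersingular_cubic F _ (polyred p c%:P) (polyred p lam%:P)
   (polyred p 'X^((3 ^ n).+1)) cardF3); last first.
  have pX (a : k) i : polyred p a%:P ^+ i = polyred p (a ^+ i)%:P.
    by rewrite polyC_exp rmorphXn.
  by rewrite !pX -(rmorphM (polyred p)) -polyCM lam_c polyCN rmorphN rmorph1.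
have nlE : - polyred p lam%:P = polyred p (- lam)%:P by rewrite polyCN rmorphN.
rewrite nlE !gauss_place ?oppr_eq0 //; last first.
  by rewrite (expN3 cardk3) lP mulrN.
rewrite /place_char /hpoly !rmorphM /=; ring.
Qed.

Lemma local_factor_place :
  map_poly (intr : int -> algC) (local_factor (curve_E n c) (Some p)) =
  1 - ((- q%:R) ^+ d * (place_char (hpoly n lam) p + place_char (hpoly n (- lam)) p))
        *: 'X^d + (q ^ (2 * d))%:R *: 'X^(2 * d).
Proof.
rewrite /local_factor -/d.
have -> : good_reduction (curve_E n c) (Some p).
  have [u [r [s [t [u0 redE]]]]] := reduction_finite n p cardk3 c_neq0.
  rewrite /good_reduction redE disc_change_vars // disc_short_char3; last first.
    exact: three_eq0 cardF3.
  apply: mulf_neq0; last exact: invr_neq0 (expf_neq0 12 u0).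
  by rewrite oppr_eq0 expf_neq0 // polyred_const_neq0.
rewrite rmorphD rmorphB rmorph1 !rmorphM /= !map_polyXn !map_polyC /= trace_place.
by rewrite -pmulrn cardk -expnM !mul_polyC.
Qed.

End FiniteLocalFactor.

Lemma odd_half_exp3 n : odd ((3 ^ n - 1) %/ 2) = odd n.
Proof.
suff [m mE] : exists m, (3 ^ n = (2 * (2 * m + odd n)).+1)%N.
  by rewrite mE subn1 /= mulKn // oddD oddM /=; case: (odd n).
elim: n => [|n [m mE]]; first by exists 0%N.
rewrite expnS mE /=; case: (odd n) => /=.
  by exists (3 * m + 2)%N; lia.
by exists (3 * m)%N; lia.
Qed.

(** Take x with x^2 = -c and lam = x^-3. Then x^q = x (-c)^((q-1)/2); since (q-1)/2 has the parity
    of n, the condition on b makes this x (-1)^n (-1)^(n+1) = -x. *)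
Lemma exists_lam n (Fq k : finFieldType) (iota : {rmorphism Fq -> k}) (b : Fq) :
  (0 < n)%N -> #|Fq| = (3 ^ n)%N -> #|k| = ((3 ^ n) ^ 2)%N -> b != 0 ->
  b ^+ ((3 ^ n - 1) %/ 2)%N = (-1) ^+ n.+1 ->
  exists2 lam : k, lam ^+ 2 * iota b ^+ 3 = -1 & lam ^+ (3 ^ n) = - lam.
Proof.
move=> n0 cFq ck b0 hb.
have ck3 : #|k| = (3 ^ (n * 2))%N by rewrite ck expnM.
have bq : (- iota b) ^+ (3 ^ n) = - iota b.
  by rewrite (expN3 ck3) -rmorphXn -cFq expf_card.
have nb0 : - iota b != 0 by rewrite oppr_eq0 fmorph_eq0.
have [x x2 x0] := exp3_fixed_sqr n0 ck bq nb0.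
have xq : x ^+ (3 ^ n) = - x.
  have e : (3 ^ n = (2 * ((3 ^ n - 1) %/ 2)).+1)%N.
    have : odd (3 ^ n) by rewrite oddX orbT.
    by move: (3 ^ n)%N => P; lia.
  rewrite e exprS exprM x2 exprNn -rmorphXn hb -signr_odd odd_half_exp3 signr_odd.
  rewrite rmorphXn rmorphN1 exprS mulN1r mulrN -expr2 -exprM mulnC exprM.
  by rewrite sqrrN !expr1n mulrN1.
exists (x ^- 3); last first.
  have -> : (x ^- 3) ^+ (3 ^ n) = (x ^+ (3 ^ n)) ^- 3.
    by rewrite exprVn -!exprM mulnC.
  by rewrite xq (expN3 ck3 1 x) invrN.
have -> : iota b = - x ^+ 2 by rewrite x2 opprK.
by field.
Qed.

(** * Power series *)

Definition eq_upto (R : nzRingType) (N : nat) (f g : nat -> R) : Prop :=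
  forall i, (i <= N)%N -> f i = g i.

Lemma eq_upto_mul (R : nzRingType) N (p p' r r' : {poly R}) :
  eq_upto N (nth 0 p) (nth 0 p') -> eq_upto N (nth 0 r) (nth 0 r') ->
  eq_upto N (nth 0 (p * r)) (nth 0 (p' * r')).
Proof.
move=> hp hr i iN; rewrite !coefM; apply: eq_bigr => -[j /= ji] _.
by rewrite hp ?hr //; apply: leq_trans iN; rewrite ?leq_subr // -ltnS.
Qed.

(** [fps_inv] with the number of terms frozen at N + 1, which makes it a polynomial; the additional
    terms start beyond the coefficient being read. *)
Definition geom_inv (R : nzRingType) N (p : {poly R}) : {poly R} :=
  \sum_(j < N.+1) (1 - p) ^+ j.

Lemma coef_exp_small (R : comNzRingType) (p : {poly R}) i j :
  p`_0 = 0 -> (i < j)%N -> (p ^+ j)`_i = 0.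
Proof.
move=> p0; elim: j i => // j IH i ij; rewrite exprS coefM big1 // => -[l /= li] _.
case: l li => [|l] li; first by rewrite p0 mul0r.
by rewrite IH ?mulr0 //; lia.
Qed.

Lemma fps_inv_geom N (p : {poly int}) : p`_0 = 1 ->
  eq_upto N (fps_inv p) (nth 0 (geom_inv N p)).
Proof.
move=> p0 i iN; rewrite /fps_inv /geom_inv !coef_sum.
rewrite (big_ord_widen N.+1 (fun j => ((1 - p) ^+ j)`_i)) // big_mkcond /=.
apply: eq_bigr => j _; case: ifP => // /negbT; rewrite -leqNgt => ij.
by rewrite coef_exp_small // coefB coef1 p0 subrr.
Qed.

Lemma geom_invP (R : comNzRingType) N (p : {poly R}) : p`_0 = 1 ->
  eq_upto N (nth 0 (p * geom_inv N p)) (nth 0 (1 : {poly R})).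
Proof.
move=> p0 i iN; have -> : p * geom_inv N p = 1 - (1 - p) ^+ N.+1.
  rewrite -[LHS]opprK -mulNr -[X in X * _](addrK 1) /geom_inv.
  have -> : - p + 1 - 1 = (1 - p) - 1 by ring.
  by rewrite -subrX1 opprB.
by rewrite coefB coef_exp_small ?subr0 // coefB coef1 p0 subrr.
Qed.

Lemma fps_bigmul N (I : Type) (s : seq I) (f : I -> fps) (g : I -> {poly int}) :
  (forall i, eq_upto N (f i) (nth 0 (g i))) ->
  eq_upto N (\big[fps_mul/fps_of_poly 1]_(i <- s) f i) (nth 0 (\prod_(i <- s) g i)).
Proof.
move=> fg; elim: s => [|i s IH] m mN; first by rewrite !big_nil.
rewrite !big_cons coefM /fps_mul; apply: eq_bigr => -[j /= jm] _.
by rewrite fg ?IH //; apply: leq_trans mN; rewrite ?leq_subr // -ltnS.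
Qed.

Lemma fps_prod_to_uniq (I : eqType) (f : I -> fps) l l' :
  fps_prod_to f l -> fps_prod_to f l' -> l = l'.
Proof.
move=> h h'; apply: functional_extensionality => n.
have [s0 hs] := h n; have [s0' hs'] := h' n.
rewrite -(hs (undup (s0 ++ s0'))) ?undup_uniq; last first.
- by move=> x; rewrite mem_undup mem_cat => ->.
- by [].
by apply: hs'; rewrite ?undup_uniq // => x; rewrite mem_undup mem_cat orbC => ->.
Qed.

Lemma fps_prod_inv (I : eqType) (L : I -> {poly int}) (T : {poly int}) :
  (forall i, (L i)`_0 = 1) ->
  (forall N, exists s0 : seq I, forall s, uniq s -> {subset s0 <= s} ->
     eq_upto N (nth 0 (\prod_(i <- s) L i * T)) (nth 0 (1 : {poly int}))) ->
  fps_prod_to (fun i => fps_inv (L i)) (fps_of_poly T).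
Proof.
move=> L0 h N; have [s0 hs] := h N; exists s0 => s us ss.
rewrite (fps_bigmul s (fun i => @fps_inv_geom N _ (L0 i)) (leqnn N)) /fps_of_poly.
set G := \prod_(i <- s) _; set Q := \prod_(i <- s) L i.
have QG : eq_upto N (nth 0 (Q * G)) (nth 0 (1 : {poly int})).
  rewrite /Q /G -big_split /=; elim: (s) => [|i s' IH]; first by rewrite big_nil.
  by have := eq_upto_mul (@geom_invP _ N _ (L0 i)) IH; rewrite mulr1 big_cons.
have e1 := eq_upto_mul QG (fun i _ => erefl (T`_i)).
have e2 := eq_upto_mul (hs s us ss) (fun i _ => erefl (G`_i)).
by rewrite -[T]mul1r -e1 // -[G]mul1r -e2 //; congr nth; congr polyseq; rewrite -/Q; ring.
Qed.

Lemma Lfunction_eq (k : finFieldType) (E : weierstrass {fraction {poly k}}) l :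
  fps_prod_to (fun v : place k => fps_inv (local_factor E v)) l -> Lfunction E = l.
Proof.
move=> h; apply: fps_prod_to_uniq (h); apply: epsilon_spec.
by exists l.
Qed.

(** Any admissible fraction satisfies N = D T, and multiplicities add, so the order does not depend
    on the fraction and the [epsilon] in [analytic_rank] is determined. *)
Lemma order_at_poly (T : {poly int}) (x : rat) (r : int) : T != 0 ->
  order_at (fps_of_poly T) x r <-> r = (mup x (map_poly intr T : {poly rat}))%:Z.
Proof.
move=> T0; set TQ := map_poly _ T.
have TQ0 : TQ != 0.
  apply: contra T0 => /eqP h; apply/eqP/polyP => i; apply: (@intr_inj rat).
  by rewrite -coef_map_id0 // -/TQ h !coef0.
split=> [[N [D [N0 D0 ND ->]]]|->].
  have NE : N = D * TQ.
    apply/polyP => n; rewrite -ND coefM; apply: eq_bigr => i _.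
    by rewrite coef_map_id0.
  by rewrite NE mupM // PoszD addrAC subrr add0r.
exists TQ, 1; split=> //; rewrite ?oner_neq0 //.
  move=> n; rewrite -[TQ]mul1r coefM; apply: eq_bigr => i _.
  by rewrite coef_map_id0.
have -> : mup x (1 : {poly rat}) = 0%N by apply: mupNroot; rewrite rootE hornerC oner_eq0.
by rewrite subr0.
Qed.

Definition places_upto (k : finFieldType) (N : nat) : seq (finite_place k) :=
  pmap insub [seq polyn x | x <- enum {poly_(N.+1) k}].

Lemma mem_places_upto (k : finFieldType) N (p : finite_place k) :
  (place_deg (Some p) <= N)%N -> p \in places_upto k N.
Proof.
move=> h; have sp : (size (sval p) <= N.+1)%N by move: h; rewrite /place_deg; lia.
rewrite /places_upto mem_pmap_sub; apply/mapP.
by exists (NPoly sp); rewrite ?mem_enum.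
Qed.

(** * The L-function and the analytic rank *)

Section CurveLfunction.
Variables (k : finFieldType) (n : nat) (c lam : k).
Let q := (3 ^ n)%N.
Hypotheses (n_gt0 : (0 < n)%N) (cardk : #|k| = (q ^ 2)%N) (c_neq0 : c != 0).
Hypotheses (lam_c : lam ^+ 2 * c ^+ 3 = -1) (lam_frob : lam ^+ q = - lam).

Let cardk3 : #|k| = (3 ^ (n * 2))%N. Proof. by rewrite cardk /q expnM. Qed.

Definition Lpoly : {poly int} := (1 - ((q ^ 2)%N%:R)%:P * 'X) ^+ (2 * q).

Lemma local_factor_coef0 (E : weierstrass {fraction {poly k}}) v : (local_factor E v)`_0 = 1.
Proof.
have dv : (0 < place_deg v)%N by case: v => // p; exact: place_deg_gt0.
have h (a : int) e : (0 < e)%N -> (a%:P * 'X^e)`_0 = 0.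
  by case: e => // e _; rewrite coefCM coefXn mulr0.
rewrite /local_factor; case: ifP => _; rewrite !(coefD, coefN) coef1 !h ?oppr0 ?addr0 //.
by rewrite muln_gt0.
Qed.

Lemma Lfunction_curve : Lfunction (curve_E n c) = fps_of_poly Lpoly.
Proof.
apply: Lfunction_eq; apply: fps_prod_inv => [v|N]; first exact: local_factor_coef0.
(* Any larger list s is handled directly: places of degree above N do not enter the power sums of
   index at most N. *)
exists [seq Some p | p <- places_upto k N] => s us ss i iN.
pose s' : seq (finite_place k) := pmap id s.
have us' : uniq s' by apply: (@pmap_uniq _ _ _ Some) => [[]|].
have fs' p : (place_deg (Some p) <= N)%N -> p \in s'.
  by move=> /mem_places_upto h; rewrite mem_pmap map_id; apply: ss; exact: map_f.
have -> : \prod_(v <- s) local_factor (curve_E n c) v =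
    \prod_(p <- s') local_factor (curve_E n c) (Some p).
  rewrite /s'; elim: (s) => [|[p|] s1 IH]; first by rewrite !big_nil.
    by rewrite /= !big_cons IH.
  by rewrite /= big_cons IH (local_factor_infty cardk3 c_neq0 n_gt0) mul1r.
have l0 : lam != 0.
  apply/eqP => l0; move/eqP: lam_c; rewrite l0 expr0n mul0r eq_sym oppr_eq0.
  by rewrite oner_eq0.
have /dvdp_XnP/(_ i) := euler_product_pair n_gt0 cardk us' fs' l0 lam_frob.
rewrite ltnS => /(_ iN); rewrite coefB => /eqP; rewrite subr_eq0 => /eqP h.
(* The factors are integral, but they split into character values only over [algC], so coefficients
   are compared there. *)
apply: (@intr_inj algC); rewrite -!(coef_map_id0 (f := intr : int -> algC)) //.
rewrite rmorph1 -h rmorphM rmorph_prod; apply: (congr1 (fun f : {poly algC} => f`_i)).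
congr (_ * _).
  apply: eq_bigr => p _; exact: (local_factor_place p n_gt0 cardk c_neq0 lam_c lam_frob).
rewrite rmorphXn /= rmorphB rmorph1 rmorphM /= map_polyX map_polyC /= rmorph_nat.
by rewrite mul_polyC.
Qed.

Lemma Lpoly_mup : mup (#|k|%:R^-1) (map_poly intr Lpoly : {poly rat}) = (2 * q)%N.
Proof.
rewrite /Lpoly -cardk rmorphXn /= rmorphB rmorph1 rmorphM /= map_polyX map_polyC /=.
rewrite rmorph_nat; set a : rat := #|k|%:R.
have a0 : a != 0 by rewrite pnatr_eq0 -lt0n ltnW ?finNzRing_gt1.
have -> : 1 - a%:P * 'X = (- a)%:P * ('X - a^-1%:P).
  by rewrite mulrBr -polyCM mulNr divff // polyCN mulNr polyCN polyC1 opprK addrC.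
rewrite exprMn mupMr ?mup_XsubCX ?eqxx //.
by rewrite -rmorphXn rootE hornerC expf_neq0 // oppr_eq0.
Qed.

Lemma Lpoly_neq0 : Lpoly != 0.
Proof.
apply/eqP => /(congr1 (fun f : {poly int} => f.[0])).
by rewrite /Lpoly horner0 !hornerE expr1n => /eqP; rewrite oner_eq0.
Qed.

Lemma analytic_rank_curve : analytic_rank (curve_E n c) = (2 * q)%N%:Z.
Proof.
rewrite -Lpoly_mup; apply/(order_at_poly _ _ Lpoly_neq0).
rewrite /analytic_rank Lfunction_curve; apply: epsilon_spec.
by eexists; apply/(order_at_poly _ _ Lpoly_neq0).
Qed.

End CurveLfunction.

Theorem theoremA (n : nat) (n_ge1 : (1 <= n)%N)
    (Fq : finFieldType) (card_Fq : #|Fq| = (3 ^ n)%N)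
    (k : finFieldType) (card_k : #|k| = ((3 ^ n) ^ 2)%N)
    (iota : {rmorphism Fq -> k})
    (b : Fq) (b_neq0 : b != 0)
    (b_char : b ^+ ((3 ^ n - 1) %/ 2)%N = (-1) ^+ n.+1) :
  [/\ elliptic (curve_E n (iota b)),
      Lfunction (curve_E n (iota b)) =
        fps_of_poly ((1 - (((3 ^ n) ^ 2)%N%:R)%:P * 'X) ^+ (2 * 3 ^ n))
    & analytic_rank (curve_E n (iota b)) = (2 * 3 ^ n)%N%:Z].
Proof.
have c0 : iota b != 0 by rewrite fmorph_eq0.
have [lam lam_c lam_q] := exists_lam iota n_ge1 card_Fq card_k b_neq0 b_char.
have card_k3 : #|k| = (3 ^ (n * 2))%N by rewrite card_k expnM.
split; first exact: disc_curve_neq0 card_k3 c0.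
  exact: Lfunction_curve n_ge1 card_k c0 lam_c lam_q.
exact: analytic_rank_curve n_ge1 card_k c0 lam_c lam_q.
Qed.
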